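(* Let $G$ be a TIE-fighter graph. Then $G$ is not troplanar.
   Context: Graphs are finite; loops and multiple edges are allowed (a loop counts twice towards the degree). A graph is trivalent if every vertex has degree $3$. The genus of a connected graph is $|E|-|V|+1$. A bridge is an edge whose deletion increases the number of connected components. Troplanar graphs. A lattice polygon is a (convex) polygon in $\mathbb{R}^2$ with vertices in $\mathbb{Z}^2$; its genus is its number of interior lattice points. A unimodular triangulation of a lattice polygon is a subdivision into lattice triangles of area $1/2$, any two meeting in a common face (edge, vertex or empty set). It is regular if there is a height function $(i,j)\mapsto a_{ij}\in\mathbb{R}$ on the lattice points of the polygon such that the triangulation is the projection of the lower faces of the convex hull of the points $(i,j,a_{ij})\in\mathbb{R}^3$. Let $\Delta$ be a lattice polygon of genus $g\ge 2$ with a regular unimodular triangulation $\mathcal{T}$. A smooth tropical plane curve dual to $\mathcal{T}$ has one vertex for each triangle of $\mathcal{T}$, an edge joining two vertices exactly when the triangles share an edge, and a ray for each boundary edge. Its skeleton is the graph obtained by removing all rays, iteratively removing $1$-valent vertices together with their edges, and then smoothing over all $2$-valent vertices; it is a connected trivalent planar graph of genus $g$. A graph is tropically planar (troplanar) if it is isomorphic to a skeleton obtained in this way. TIE-fighter graphs. A connected trivalent planar graph $G$ is called a TIE-fighter graph if it has two distinct vertices $v_1,v_2$ and four pairwise vertex-disjoint connected subgraphs $H_1,H_2,G_1,G_2$, each of positive genus and none containing $v_1$ or $v_2$, which together with $v_1,v_2$ contain all vertices of $G$, such that the edges of $G$ not belonging to $H_1,H_2,G_1,G_2$ are exactly the following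 six: for each $i\in\{1,2\}$, one edge $e_i$ (a bridge) joining $v_i$ to a vertex of $H_i$, one edge joining $v_i$ to a vertex of $G_1$, and one edge joining $v_i$ to a vertex of $G_2$. (Thus $v_1$ and $v_2$ lie on a common cycle passing through $G_1$ and $G_2$.) *)

(* Defs.v *)
From HB Require Import structures.
From mathcomp Require Import all_boot all_order all_algebra finmap.

Set Implicit Arguments.
Unset Strict Implicit.
Unset Printing Implicit Defensive.

Import Order.TTheory GRing.Theory Num.Theory.
Local Open Scope ring_scope.

(** * Multigraphs *)

(* Finite graphs with loops and multiple edges, in Serre's style: an edge is a
   pair {d, flip d} of opposite darts (half-edges), the dart d running from
   [base d] to [base (flip d)].  A loop has both its darts based at the same
   vertex, hence counts twice in the degree. *)
Record mgraph := Mgraph {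
  vertex : finType;
  dart : finType;
  base : dart -> vertex;
  flip : dart -> dart;
  flipK : involutive flip;
  flip_neq : forall d, flip d != d }.

Section Mgraph.
Variable G : mgraph.
Implicit Types (v x y : vertex G) (d : dart G).

Definition degree v := #|[set d | base d == v]|.

Definition trivalent := forall v, degree v = 3%N.

Definition adj : rel (vertex G) :=
  fun x y => [exists d : dart G, (base d == x) && (base (flip d) == y)].

Definition nb_components : nat := n_comp adj (vertex G).

Definition connected_graph := (0 < #|vertex G|)%N /\ forall x y, connect adj x y.

Definition nb_edges : nat := #|dart G|./2.

Definition graph_genus : int := nb_edges%:Z - #|vertex G|%:Z + 1.

Record subgraph := Subgraph {
  sub_vertices : {set vertex G};
  sub_darts : {set dart G};
  sub_base : forall d, d \in sub_darts -> base d \in sub_vertices;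
  sub_flip : forall d, d \in sub_darts -> flip d \in sub_darts }.

Definition vertex_disjoint (H K : subgraph) : bool :=
  [disjoint sub_vertices H & sub_vertices K].

End Mgraph.

Section SubgraphGraph.
Variables (G : mgraph) (H : subgraph G).

Definition subgraph_base (d : {d | d \in sub_darts H}) :
    {x | x \in sub_vertices H} :=
  exist _ (base (sval d)) (sub_base (svalP d)).

Definition subgraph_flip (d : {d | d \in sub_darts H}) :
    {d | d \in sub_darts H} :=
  exist _ (flip (sval d)) (sub_flip (svalP d)).

Fact subgraph_flipK : involutive subgraph_flip.
Proof. by move=> d; apply: val_inj; rewrite /= flipK. Qed.

Fact subgraph_flip_neq d : subgraph_flip d != d.
Proof. by rewrite -(inj_eq val_inj) /= flip_neq. Qed.

Definition graph_of_subgraph : mgraph :=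
  @Mgraph {x | x \in sub_vertices H} {d | d \in sub_darts H}
    subgraph_base subgraph_flip subgraph_flipK subgraph_flip_neq.

End SubgraphGraph.

Coercion graph_of_subgraph : subgraph >-> mgraph.

Section Deletion.
Variable G : mgraph.

Fact delete_edge_base (d0 d : dart G) :
  d \in ~: [set d0; flip d0] -> base d \in [set: vertex G].
Proof. by rewrite inE. Qed.

Fact delete_edge_flip (d0 d : dart G) :
  d \in ~: [set d0; flip d0] -> flip d \in ~: [set d0; flip d0].
Proof.
rewrite !inE !negb_or (inj_eq (can_inj (@flipK G))) => /andP[dd0 drd0].
by rewrite dd0 andbT; apply: contra drd0 => /eqP <-; rewrite flipK.
Qed.

Definition delete_edge (d0 : dart G) : subgraph G :=
  Subgraph (@delete_edge_base d0) (@delete_edge_flip d0).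

Definition bridge (d0 : dart G) : Prop :=
  (nb_components G < nb_components (delete_edge d0))%N.

Fact delete_vertex_base (v : vertex G) (d : dart G) :
  d \in [set d | (base d != v) && (base (flip d) != v)] ->
  base d \in ~: [set v].
Proof. by rewrite !inE => /andP[]. Qed.

Fact delete_vertex_flip (v : vertex G) (d : dart G) :
  d \in [set d | (base d != v) && (base (flip d) != v)] ->
  flip d \in [set d | (base d != v) && (base (flip d) != v)].
Proof. by rewrite !inE flipK andbC. Qed.

Definition delete_vertex (v : vertex G) : subgraph G :=
  Subgraph (@delete_vertex_base v) (@delete_vertex_flip v).

End Deletion.

Definition graph_iso (G G' : mgraph) : Prop :=
  exists (fV : vertex G -> vertex G') (fD : dart G -> dart G'),
    [/\ bijective fV, bijective fD,
        forall d, base (fD d) = fV (base d) &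
        forall d, flip (fD d) = fD (flip d)].

(** * Skeletons *)

Inductive prune : mgraph -> mgraph -> Prop :=
| prune_refl G : prune G G
| prune_step G (v : vertex G) G' :
    degree v = 1%N -> prune (delete_vertex v) G' -> prune G G'.

(* [smoothing_at v G'] : v is a 2-valent vertex not carrying a loop, and G' is
   obtained from G by replacing v and its two edges, v -- x and v -- y, by a
   single edge x -- y (a loop if x = y).  Identifying the darts of G' with the
   darts of G not based at v, the reverse of a dart is unchanged unless that
   dart points to v, in which case it becomes the other dart pointing to v. *)
Definition smoothing_at (G : mgraph) (v : vertex G) (G' : mgraph) : Prop :=
  [/\ degree v = 2%N,
      forall d : dart G, base d = v -> base (flip d) <> v &
      exists (fV : vertex G' -> vertex G) (fD : dart G' -> dart G),
        [/\ injective fV /\ (forall x, (exists x', fV x' = x) <-> x <> v),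
            injective fD /\ (forall d, (exists d', fD d' = d) <-> base d <> v),
            forall d', base (fD d') = fV (base d') &
            forall d', flip (fD d') = fD (flip d') \/
              (base (flip (fD d')) = v /\ base (flip (fD (flip d'))) = v)]].

Inductive smoothing : mgraph -> mgraph -> Prop :=
| smoothing_refl G : smoothing G G
| smoothing_step G (v : vertex G) G' G'' :
    smoothing_at v G' -> smoothing G' G'' -> smoothing G G''.

Definition is_skeleton (G S : mgraph) : Prop :=
  exists C : mgraph,
    [/\ prune G C, forall v : vertex C, degree v <> 1%N,
        smoothing C S & forall v : vertex S, degree v <> 2%N].

(** * Graph dual to a triangulation *)

(* Lattice points of the plane. *)
Notation Z2 := 'rV[int]_2.

Section DualGraph.
Local Open Scope fset_scope.

Variable T : {fset {fset Z2}}.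

Definition share_edge (s t : {fset Z2}) : bool :=
  (s != t) && (#|` s `&` t| == 2).

(* The dart (s, t) crosses the common edge of s and t from s to t.  The rays
   of the dual tropical curve, which the skeleton discards first, are left
   out. *)
Definition dual_dart : Type := {st : T * T | share_edge (val st.1) (val st.2)}.

Definition dual_base (d : dual_dart) : T := (sval d).1.

Fact dual_flip_subproof (d : dual_dart) :
  share_edge (val (sval d).2) (val (sval d).1).
Proof. by have := svalP d; rewrite /share_edge eq_sym fsetIC. Qed.

Definition dual_flip (d : dual_dart) : dual_dart :=
  exist (fun st : T * T => share_edge (val st.1) (val st.2))
    ((sval d).2, (sval d).1) (dual_flip_subproof d).

Fact dual_flipK : involutive dual_flip.
Proof. by move=> d; apply: val_inj => /=; case: (sval d). Qed.

Fact dual_flip_neq d : dual_flip d != d.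
Proof.
case: d => -[s t] /= st; rewrite -(inj_eq val_inj) /=.
by apply/eqP => -[ts _]; move: st; rewrite ts /share_edge eqxx.
Qed.

Definition dual_graph : mgraph :=
  @Mgraph T dual_dart dual_base dual_flip dual_flipK dual_flip_neq.

End DualGraph.

(** * Plane geometry *)

From mathcomp Require Import all_classical all_reals all_analysis.
Import numFieldNormedType.Exports.
Local Open Scope classical_set_scope.

Section Geometry.
Variable R : realType.

(* A dart and its reverse carry the same arc, traversed in opposite
   directions. *)
Definition planar (G : mgraph) : Prop :=
  exists (p : vertex G -> 'rV[R]_2) (gamma : dart G -> R -> 'rV[R]_2),
    [/\ injective p,
        forall d, {within `[0, 1]%classic, continuous (gamma d)},
        forall d, gamma d 0 = p (base d),
        forall d (t : R), 0 <= t <= 1 -> gamma (flip d) t = gamma d (1 - t) &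
        (forall d (t : R) v, 0 < t < 1 -> gamma d t <> p v) /\
        (forall d d' (t t' : R), 0 < t < 1 -> 0 < t' < 1 ->
           gamma d t = gamma d' t' ->
           (d' = d /\ t' = t) \/ (d' = flip d /\ t' = 1 - t))].

Definition convex_hull (V : lmodType R) (A : set V) : set V :=
  [set x | exists (n : nat) (w : 'I_n -> R) (p : 'I_n -> V),
     [/\ forall i, 0 <= w i, forall i, A (p i), \sum_i w i = 1 &
         x = \sum_i w i *: p i]].

Definition embed (p : Z2) : 'rV[R]_2 := map_mx intr p.

Definition lattice_hull (s : {fset Z2}) : set 'rV[R]_2 :=
  convex_hull (embed @` [set` s]).

Definition lattice_polygon (D : set 'rV[R]_2) : Prop :=
  (exists A : {fset Z2}, D = lattice_hull A) /\ interior D !=set0.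

Definition polygon_genus (D : set 'rV[R]_2) (g : nat) : Prop :=
  ([set p : Z2 | interior D (embed p)] #= `I_g)%card.

Definition triangle_area (p q r : Z2) : R :=
  `|\det (col_mx (embed q - embed p) (embed r - embed p) : 'M[R]_2)| / 2.

Definition unimodular_triangle (t : {fset Z2}) : Prop :=
  exists p q r : Z2, t = [fset p; q; r]%fset /\ triangle_area p q r = 1 / 2.

(* A triangle is given by its vertices; the faces of a triangle are the hulls
   of the subsets of its vertices. *)
Definition unimodular_triangulation
    (D : set 'rV[R]_2) (T : {fset {fset Z2}}) : Prop :=
  [/\ forall t, t \in T -> unimodular_triangle t,
      \bigcup_(t in [set` T]) lattice_hull t = D &
      forall s t, s \in T -> t \in T -> exists f : {fset Z2},
        [/\ (f `<=` s)%fset, (f `<=` t)%fset &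
            lattice_hull s `&` lattice_hull t = lattice_hull f]].

Definition lift_point (a : Z2 -> R) (p : Z2) : 'rV[R]_(2 + 1) :=
  row_mx (embed p) (a p)%:M.

(* The lower faces of P are the nonempty faces of P, of any dimension, on which
   some linear functional with last coefficient 1 is minimal, i.e. those with
   a downward-pointing outer normal vector. *)
Definition lower_faces (P : set 'rV[R]_(2 + 1)) : set (set 'rV[R]_(2 + 1)) :=
  [set F | F !=set0 /\ exists (c : 'cV[R]_2) (b : R),
     let l := fun x : 'rV[R]_(2 + 1) => (lsubmx x *m c + rsubmx x) 0 0 in
     (forall x, P x -> b <= l x) /\ F = [set x | P x /\ l x = b]].

Definition triangulation_faces (T : {fset {fset Z2}}) :
    set (set 'rV[R]_2) :=
  [set lattice_hull s | s in
     [set s | s <> fset0 /\ exists2 t, t \in T & (s `<=` t)%fset]].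

Definition regular (D : set 'rV[R]_2) (T : {fset {fset Z2}}) : Prop :=
  exists a : Z2 -> R,
    [set [set lsubmx x | x in F] | F in
       lower_faces
         (convex_hull [set lift_point a p | p in [set p | D (embed p)]])]
    = triangulation_faces T.

(** * Troplanar and TIE-fighter graphs *)

Definition troplanar (G : mgraph) : Prop :=
  exists (D : set 'rV[R]_2) (g : nat) (T : {fset {fset Z2}}) (S : mgraph),
    [/\ lattice_polygon D /\ (polygon_genus D g /\ (2 <= g)%N),
        unimodular_triangulation D T, regular D T,
        is_skeleton (dual_graph T) S & graph_iso G S].

(* The subgraphs called G_1, G_2 are K 0, K 1; the edge from v i to K j is
   [f i j]. *)
Definition tie_fighter (G : mgraph) : Prop :=
  [/\ connected_graph G, trivalent G, planar G &
   exists (v : 'I_2 -> vertex G) (H K : 'I_2 -> subgraph G)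
          (e : 'I_2 -> dart G) (f : 'I_2 -> 'I_2 -> dart G),
     let VH i := sub_vertices (H i) in
     let VK i := sub_vertices (K i) in
     let EH i := sub_darts (H i) in
     let EK i := sub_darts (K i) in
     [/\ injective v
         /\ (forall i, [/\ connected_graph (H i), connected_graph (K i),
                           0 < graph_genus (H i) & 0 < graph_genus (K i)]),
         [/\ forall i j, i != j -> vertex_disjoint (H i) (H j),
             forall i j, i != j -> vertex_disjoint (K i) (K j) &
             forall i j, vertex_disjoint (H i) (K j)],
         (forall i j, v i \notin VH j /\ v i \notin VK j)
         /\ (forall x, (exists i, x = v i) \/
                       (exists i, x \in VH i \/ x \in VK i)),
         (forall i, [/\ bridge (e i), base (e i) = v i &
                        base (flip (e i)) \in VH i])
         /\ (forall i j, base (f i j) = v i /\ base (flip (f i j)) \in VK j) &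
         forall d,
           (forall i, d \notin EH i /\ d \notin EK i) <->
           (exists i, d = e i \/ d = flip (e i)) \/
           (exists i j, d = f i j \/ d = flip (f i j))]].

End Geometry.

(* Main.v *)
From HB Require Import structures.
From mathcomp Require Import all_boot all_order all_algebra finmap.
From mathcomp Require Import zify ring lra.
Require Import Defs.
From mathcomp Require Import all_reals.

(** Let T be a unimodular triangulation of a lattice polygon D whose dual graph
    has a TIE-fighter graph as its skeleton. Smoothing and pruning can be undone
    without losing the shape of a TIE-fighter graph, so every triangle of T
    belongs to one of six pieces: two hubs, which are single triangles, two wings
    and two pods ([skeleton_tie_labelling]). Each hub has one neighbour in its own
    wing and one in each pod.

    Let abc be the triangle of a hub, with ab its edge towards the wing. The
    frontier, inside D, of the union of the wing is the single edge ab. Around an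
    interior lattice point the number of edges in the frontier of a set of
    triangles is even ([frontier_edge_not_alone]), so a and b lie on the boundary
    of D. The frontier of a pod consists of one edge of each hub. If c were on the
    boundary as well, the edges of the triangle would cut D into pieces, and the
    other hub could not be reached through both pods; so c is interior, and the
    parity count at c shows that the other hub is a triangle a'b'c with the same
    apex ([hub_apex_interior], [hub_apex_in_other]). Moreover a wing has a cycle,
    and a cycle in the dual graph crosses an edge with an interior end
    ([core_interior_vertex]), so D has an interior lattice point y beyond ab.

    Take coordinates with origin c and basis a, b. As D is convex, a and b are on
    its boundary, and c and y are interior, no lattice point of D has coordinates
    of opposite signs: it lies in the angle of the hub or in the opposite one
    ([vertical_angles]). The same holds for the other hub, which moreover lies in
    the angle opposite to that of abc ([hub_in_opposite_angle]). Hence every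
    lattice point of D lies in the angle of one of the hubs, and between the hubs
    there is no room for a pod with a cycle: the vertices of a triangle in a pod
    are among a, b, c, a', b', and this leaves a single triangle
    ([no_tie_fighter_triangulation]). *)

Set Implicit Arguments.
Unset Strict Implicit.
Unset Printing Implicit Defensive.

Import Order.TTheory GRing.Theory Num.Theory.

(** * Cores of multigraphs *)

(** A core witnesses positive genus: its darts are those of a nonempty subgraph
    without vertices of degree 0 or 1. Unlike a count of edges and vertices it is
    easily carried along subdivisions and pendant trees. *)
Definition is_core (G : mgraph) (A : {set dart G}) : Prop :=
  [/\ A != set0, forall d, d \in A -> flip d \in A &
      forall d, d \in A -> exists d', [/\ d' \in A, base d' = base d & d' != d]].

(** Removing an edge at a vertex of degree 1 loses one edge and at least one
    vertex, so a graph with at least as many edges as vertices is never pruned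
    to nothing. *)
Lemma core_of_many_darts (G : mgraph) (A : {set dart G}) :
    A != set0 -> (forall d, d \in A -> flip d \in A) ->
    (#|[set base d | d in A]|.*2 <= #|A|)%N ->
  exists2 B : {set dart G}, is_core B & B \subset A.
Proof.
have [n leAn] := ubnP #|A|.
elim: n A leAn => // n IHn A leAn A0 Aflip leVA.
have [/forall_inP Acomp | /forall_inPn[d dA dlone]] :=
    boolP [forall d in A, exists d' in A, (base d' == base d) && (d' != d)].
  exists A => //; split=> // d /Acomp /exists_inP[d' d'A /andP[/eqP bd' d'd]].
  by exists d'.
have lone d' : d' \in A -> base d' = base d -> d' = d.
  move=> d'A bd'; apply/eqP; apply: contraNT dlone => d'd.
  by apply/exists_inP; exists d' => //; rewrite bd' eqxx.
have fdA := Aflip d dA.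
pose B := A :\: [set d; flip d].
have dd : [set d; flip d] \subset A by apply/subsetP => x /set2P[] ->.
have cardB : (#|B|.+2 = #|A|)%N.
  by rewrite -(cardsID [set d; flip d] A) (setIidPr dd) cards2 eq_sym flip_neq.
have bfd : base (flip d) != base d.
  by apply/eqP => /(lone _ fdA) E; have := flip_neq d; rewrite E eqxx.
have leV : (#|[set base x | x in B]| < #|[set base x | x in A]|)%N.
  apply: proper_card; apply/properP; split.
    by apply: imsetS; apply: subsetDl.
  exists (base d); first exact: imset_f.
  apply/imsetP => -[x]; rewrite !inE negb_or => /andP[/andP[xd _] xA] /esym.
  by move=> /(lone _ xA) E; rewrite E eqxx in xd.
have B0 : B != set0.
  apply: contraTneq leVA => B0; rewrite -cardB B0 cards0 -ltnNge.
  have: [set base d; base (flip d)] \subset [set base x | x in A].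
    by apply/subsetP => x /set2P[] ->; apply: imset_f.
  by move/subset_leq_card; rewrite cards2 eq_sym bfd; case: #|_| => [|[|[]]].
case: (IHn B) => //; first by rewrite -ltnS (leq_trans _ leAn) // ltnS -cardB.
- move=> x; rewrite !inE !negb_or => /andP[/andP[xd xfd] xA].
  rewrite Aflip // andbT (inj_eq (can_inj (@flipK G))) xd andbT.
  by apply: contra xfd => /eqP <-; rewrite flipK.
- rewrite -(leq_add2r 2) addn2 -doubleS (leq_trans (n := #|A|)) //.
    by apply: leq_trans leVA; rewrite leq_double.
  by rewrite -cardB addn2.
by move=> C coreC CB; exists C => //; apply: subset_trans CB (subsetDl _ _).
Qed.

Lemma core_of_genus (G : mgraph) : (0 < #|vertex G|)%N ->
  (0 < graph_genus G)%R -> exists A : {set dart G}, is_core A.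
Proof.
rewrite /graph_genus /nb_edges => V0.
move=> g0.
have {}g0 : (#|vertex G| <= #|dart G|./2)%N.
  by lia.
have le2 : (#|vertex G|.*2 <= #|dart G|)%N.
  by rewrite (leq_trans (n := (#|dart G|./2).*2)) ?leq_double // -[leqRHS]odd_double_half leq_addl.
case: (@core_of_many_darts G setT) => //.
- rewrite -card_gt0 cardsT (leq_trans _ le2) //.
  by rewrite double_gt0.
- by rewrite cardsT (leq_trans _ le2) // leq_double max_card.
- by move=> B; exists B.
Qed.

Lemma core_map (G G' : mgraph) (f : dart G -> dart G') (A : {set dart G}) :
    injective f -> (forall d, flip (f d) = f (flip d)) ->
    (forall d d', base d = base d' -> base (f d) = base (f d')) ->
  is_core A -> is_core (f @: A).
Proof.
move=> finj fflip fbase [/set0Pn[d0 d0A] Aflip Acomp]; split.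
- by apply/set0Pn; exists (f d0); apply: imset_f.
- by move=> _ /imsetP[d dA ->]; rewrite fflip imset_f ?Aflip.
move=> _ /imsetP[d /Acomp[d' [d'A bd' d'd]] ->]; exists (f d').
by rewrite imset_f // (inj_eq finj); split=> //; apply: fbase.
Qed.

(** * The pieces of a TIE-fighter graph *)

(** The six pieces of a TIE-fighter graph: [hub i] is the vertex v_i, [wing i]
    the subgraph H_i behind the bridge at v_i, and [pod j] the subgraph G_j which
    both hubs touch. *)
Definition part := ('I_2 + ('I_2 + 'I_2))%type.
Definition hub (i : 'I_2) : part := inl i.
Definition wing (i : 'I_2) : part := inr (inl i).
Definition pod (j : 'I_2) : part := inr (inr j).

Definition is_hub (X : part) : bool := if X is inl _ then true else false.

Definition hub_neighbour (i : 'I_2) (X : part) : bool :=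
  match X with
  | inl _ => false
  | inr (inl k) => k == i
  | inr (inr _) => true
  end.

(** The structure of a TIE-fighter graph in a form that does not see whether the
    graph is trivalent: subdividing edges or attaching trees preserves it. For
    this purpose connectedness of a part is expressed by functions which do not
    change along its edges, and positive genus by a core. *)
Record tie_labelling (G : mgraph) (lab : vertex G -> part) : Prop := TieLabelling {
  hub_inj : forall x y, is_hub (lab x) -> lab x = lab y -> x = y;
  hub_dart_target : forall d i, lab (base d) = hub i ->
    hub_neighbour i (lab (base (flip d)));
  hub_dart_inj : forall d d', is_hub (lab (base d)) ->
    lab (base d) = lab (base d') ->
    lab (base (flip d)) = lab (base (flip d')) -> d = d';
  hub_dart_exists : forall i X, hub_neighbour i X ->
    exists d, lab (base d) = hub i /\ lab (base (flip d)) = X;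
  part_separated : forall d, ~~ is_hub (lab (base d)) ->
    ~~ is_hub (lab (base (flip d))) -> lab (base (flip d)) = lab (base d);
  part_connected : forall X (sigma : vertex G -> bool), ~~ is_hub X ->
    (forall d, lab (base d) = X -> lab (base (flip d)) = X ->
       sigma (base (flip d)) = sigma (base d)) ->
    forall x y, lab x = X -> lab y = X -> sigma x = sigma y;
  part_core : forall X, ~~ is_hub X -> exists A : {set dart G},
    is_core A /\ forall d, d \in A -> lab (base d) = X }.

Lemma hub_neighbour_not_hub i X : hub_neighbour i X -> ~~ is_hub X.
Proof. by case: X. Qed.

Lemma subgraph_core (G : mgraph) (H : subgraph G) (A : {set dart H}) :
  is_core A -> is_core [set (sval d : dart G) | d in A].
Proof.
apply: core_map => //; first exact: val_inj.
by move=> d d' /(congr1 sval).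
Qed.

Lemma subgraph_core_base (G : mgraph) (H : subgraph G) (A : {set dart H}) d :
  d \in [set (sval d : dart G) | d in A] -> base d \in sub_vertices H.
Proof. by case/imsetP => -[x xH] /= _ ->; apply: sub_base. Qed.

Lemma subgraph_connected (G : mgraph) (H : subgraph G) (sigma : vertex G -> bool) :
    connected_graph H ->
    (forall d, d \in sub_darts H -> sigma (base (flip d)) = sigma (base d)) ->
  forall x y, x \in sub_vertices H -> y \in sub_vertices H -> sigma x = sigma y.
Proof.
move=> [_ conH] sigE x y xH yH.
pose x' : vertex H := exist _ x xH; pose y' : vertex H := exist _ y yH.
suff: sigma (sval x') = sigma (sval y') by [].
have /connectP[p pp ->] : connect (@adj H) x' y' by apply: conH.
move: {xH yH y'} x' pp => x' pp.
elim: p x' pp => [|z p IHp] x' //= /andP[/existsP[[d dH]]].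
case/andP => /eqP <- /eqP <- pp; rewrite -(IHp _ pp) /=.
by rewrite sigE.
Qed.

Lemma tie_fighter_labelling R (G : mgraph) :
  tie_fighter R G -> exists lab : vertex G -> part, tie_labelling lab.
Proof.
case=> _ _ _ [v [H [K [e [f]]]]] /=.
move=> [[vinj HKprop] [Hdis Kdis HKdis] [vout cover] [eP fP] outside].
pose P (x : vertex G) (X : part) : Prop := match X with
  | inl i => x = v i
  | inr (inl i) => x \in sub_vertices (H i)
  | inr (inr j) => x \in sub_vertices (K j)
  end.
have Pfun x X Y : P x X -> P x Y -> X = Y.
  have dH i j : x \in sub_vertices (H i) -> x \in sub_vertices (H j) -> i = j.
    by move=> xi xj; apply/eqP; apply: contraTT xj => ij; rewrite (disjointFr (Hdis _ _ ij)).
  have dK i j : x \in sub_vertices (K i) -> x \in sub_vertices (K j) -> i = j.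
    by move=> xi xj; apply/eqP; apply: contraTT xj => ij; rewrite (disjointFr (Kdis _ _ ij)).
  have dHK i j : x \in sub_vertices (H i) -> x \in sub_vertices (K j) -> False.
    by move=> xi; rewrite (disjointFr (HKdis i j)).
  have dvH i j : x = v i -> x \in sub_vertices (H j) -> False.
    by move=> -> vH; case: (vout i j); rewrite vH.
  have dvK i j : x = v i -> x \in sub_vertices (K j) -> False.
    by move=> -> vK; case: (vout i j); rewrite vK.
  case: X => [i|[i|i]]; case: Y => [j|[j|j]] //= xX xY.
  - by congr inl; apply: vinj; rewrite -xX.
  - by case: (dvH _ _ xX xY).
  - by case: (dvK _ _ xX xY).
  - by case: (dvH _ _ xY xX).
  - by rewrite (dH _ _ xX xY).
  - by case: (dHK _ _ xX xY).
  - by case: (dvK _ _ xY xX).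
  - by case: (dHK _ _ xY xX).
  - by rewrite (dK _ _ xX xY).
have Pex x : exists X, P x X.
  by case: (cover x) => [[i ->]|[i [xi|xi]]];
    [exists (hub i) | exists (wing i) | exists (pod i)].
have [lab labP] := fin_all_exists Pex.
have labE x X : P x X -> lab x = X by move=> xX; apply: Pfun (labP x) xX.
have Plab x X : lab x = X -> P x X by move=> <-.
have hub_darts d i : base d = v i -> d = e i \/ exists j, d = f i j.
  move=> bd; have: forall k, d \notin sub_darts (H k) /\ d \notin sub_darts (K k).
    move=> k; have [vH vK] := vout i k.
    by split; [apply: contra vH | apply: contra vK]; rewrite -bd; apply: sub_base.
  case/outside => [[k [dE|dE]]|[k [j [dE|dE]]]].
  - have [_ bk _] := eP k; left.
    by rewrite dE; have -> : i = k by apply: vinj; rewrite -bk -dE bd.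
  - have [_ _ bk] := eP k; have [] := vout i k.
    by rewrite -bd dE bk.
  - have [bk _] := fP k j; right; exists j.
    by rewrite dE; have -> : i = k by apply: vinj; rewrite -bk -dE bd.
  - have [_ bk] := fP k j; have [] := vout i j.
    by rewrite -bd dE bk.
have lab_e i : lab (base (flip (e i))) = wing i.
  by apply: labE; have [] := eP i.
have lab_f i j : lab (base (flip (f i j))) = pod j.
  by apply: labE; have [] := fP i j.
have inner d : ~~ is_hub (lab (base d)) -> ~~ is_hub (lab (base (flip d))) ->
    exists k, d \in sub_darts (H k) \/ d \in sub_darts (K k).
  move=> nb nfb.
  have [/existsP[k /orP kP]|] :=
      boolP [exists k, (d \in sub_darts (H k)) || (d \in sub_darts (K k))].
    by exists k.
  move/existsPn => out.
  have /outside : forall k, d \notin sub_darts (H k) /\ d \notin sub_darts (K k).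
    by move=> k; have := out k; rewrite negb_or => /andP[].
  case => [[k [dE|dE]]|[k [j [dE|dE]]]].
  - have [_ bk _] := eP k; move: nb; rewrite dE (labE _ (hub k)) //.
  - have [_ bk _] := eP k; move: nfb; rewrite dE flipK (labE _ (hub k)) //.
  - have [bk _] := fP k j; move: nb; rewrite dE (labE _ (hub k)) //.
  - have [bk _] := fP k j; move: nfb; rewrite dE flipK (labE _ (hub k)) //.
exists lab; split.
- move=> x y; case E: (lab x) => [i|] // _ /esym E'.
  by rewrite (Plab _ _ E) (Plab _ _ E').
- move=> d i /Plab /hub_darts[->|[j ->]]; rewrite ?lab_e ?lab_f //=.
- move=> d d'; case E: (lab (base d)) => [i|] // _ /esym E'.
  have [->|[j ->]] := hub_darts _ _ (Plab _ _ E);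
  have [->|[j' ->]] := hub_darts _ _ (Plab _ _ E');
  by rewrite ?lab_e ?lab_f // => -[->].
- move=> i [|[k|j]] //= X.
    by exists (e i); rewrite lab_e (eqP X); split=> //; apply: labE; have [] := eP i.
  by exists (f i j); rewrite lab_f; split=> //; apply: labE; have [] := fP i j.
- move=> d nb nfb; have [k [dk|dk]] := inner d nb nfb.
    by rewrite !(labE _ (wing k)) //=; apply: sub_base => //; apply: sub_flip.
  by rewrite !(labE _ (pod k)) //=; apply: sub_base => //; apply: sub_flip.
- move=> [|[k|k]] //= sigma _ sigE x y /Plab /= xX /Plab /= yX.
    apply: (@subgraph_connected _ (H k)) => //; first by have [] := HKprop k.
    by move=> d dk; apply: sigE; apply: labE; apply: sub_base => //; apply: sub_flip.
  apply: (@subgraph_connected _ (K k)) => //; first by have [] := HKprop k.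
  by move=> d dk; apply: sigE; apply: labE; apply: sub_base => //; apply: sub_flip.
move=> [|[k|k]] //= _; have [[H0 _] [K0 _] gH gK] := HKprop k.
  have [A coreA] := core_of_genus H0 gH.
  exists [set (sval d : dart G) | d in A]; split; first exact: subgraph_core.
  by move=> d /subgraph_core_base /(labE _ (wing k)).
have [A coreA] := core_of_genus K0 gK.
exists [set (sval d : dart G) | d in A]; split; first exact: subgraph_core.
by move=> d /subgraph_core_base /(labE _ (pod k)).
Qed.

(** * Undoing isomorphisms, smoothing and pruning *)

Lemma tie_labelling_iso (G S : mgraph) (lab : vertex G -> part) :
    graph_iso G S -> tie_labelling lab ->
  exists lab' : vertex S -> part, tie_labelling lab'.
Proof.
move=> [fV [fD [[gV fVK gVK] [gD fDK gDK] fbase fflip]]].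
have gbase d : base (gD d) = gV (base d).
  by rewrite -{2}[d]gDK fbase fVK.
have gflip d : flip (gD d) = gD (flip d).
  by apply: (can_inj fDK); rewrite -fflip !gDK.
case=> linj ltarget ldinj lex lsep lcon lcore; exists (lab \o gV); split => /=.
- by move=> x y hx /(linj _ _ hx) /(can_inj gVK).
- by move=> d i; rewrite -!gbase -gflip; apply: ltarget.
- move=> d d'; rewrite -!gbase -!gflip => h1 h2 h3.
  by apply: (can_inj gDK); apply: ldinj.
- move=> i X /lex[d [d1 d2]]; exists (fD d).
  by rewrite fflip !fbase !fVK.
- by move=> d; rewrite -!gbase -gflip; apply: lsep.
- move=> X sigma nX sigE x y xX yX; rewrite -[x]gVK -[y]gVK.
  apply: (lcon X (sigma \o fV)) => //= d dX fdX.
  by rewrite -!fbase -fflip; apply: sigE; rewrite ?fflip fbase fVK.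
move=> X /lcore[A [coreA AX]]; exists (fD @: A); split.
  by apply: core_map coreA => //; [exact: can_inj fDK | move=> d d' dd; rewrite !fbase dd].
by move=> _ /imsetP[d dA ->]; rewrite fbase fVK AX.
Qed.

(** A subdividing vertex joins the part of a neighbour; if one neighbour is a hub,
    it joins the part on the other side, and so becomes the neighbour of that hub
    in this part. *)
Lemma tie_labelling_smoothing_at (G S : mgraph) (v : vertex G) (lab' : vertex S -> part) :
    smoothing_at v S -> tie_labelling lab' ->
  exists lab : vertex G -> part, tie_labelling lab.
Proof.
move=> [deg2 noloop [fV [fD [[fVinj fVim] [fDinj fDim] fbase fflip]]]].
move=> [linj ltarget ldinj lex lsep lcon lcore].
have fVv x : fV x <> v by apply/fVim; exists x.
have im_fV x : x <> v -> exists x', fV x' = x by move/fVim.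
have im_fD d : base d <> v -> exists d', fD d' = d by move/fDim.
have [d1 [d2 [bd1 bd2 d12 dv]]] : exists d1 d2, [/\ base d1 = v, base d2 = v,
    d1 != d2 & forall d, base d = v -> d = d1 \/ d = d2].
  have /cards2P[d1 [d2 [d12 E]]] : #|[set d | base d == v]| == 2%N by apply/eqP.
  exists d1, d2.
  have inE' d : (base d == v) = (d \in [set d1; d2]) by rewrite -E inE.
  split=> //; first by apply/eqP; rewrite inE' set21.
    by apply/eqP; rewrite inE' set22.
  by move=> d /eqP; rewrite inE' => /set2P.
pose cut d' := base (flip (fD d')) == v.
have cutN d' : ~~ cut d' -> flip (fD d') = fD (flip d').
  by move=> nc; case: (fflip d') => // -[/eqP]; rewrite -/(cut d') (negbTE nc).
have cut_flip d' : cut d' -> cut (flip d').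
  move=> /eqP c; case: (fflip d') => [E|[_ /eqP //]].
  by have /fDim[] : exists d, fD d = flip (fD d') by exists (flip d').
(* Both darts pointing to v come from one dart and its reverse, so, up to
   reversal, a single edge of S is cut by v. *)
have cut_dart d : base d = v -> exists2 d', cut d' & flip (fD d') = d.
  move=> bd; have [d' dE] := im_fD (flip d) (noloop d bd).
  by exists d'; rewrite /cut dE flipK ?bd.
have cut_uniq d' d'' : cut d' -> cut d'' -> d'' = d' \/ d'' = flip d'.
  have finj : injective (fun d => flip (fD d)).
    by move=> x y /(can_inj (@flipK G)) /fDinj.
  move=> c' c''; have cf' := cut_flip _ c'.
  have /eqP b' := c'; have /eqP b'' := c''; have /eqP bf' := cf'.
  have nff : flip (fD d') <> flip (fD (flip d')).
    by move/finj/eqP; rewrite eq_sym (negbTE (flip_neq _)).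
  case: (dv _ b'') => E''; case: (dv _ b') => E'; case: (dv _ bf') => Ef;
    try by (case: nff; rewrite E' Ef).
  - by left; apply: finj; rewrite E'' E'.
  - by right; apply: finj; rewrite E'' Ef.
  - by right; apply: finj; rewrite E'' Ef.
  - by left; apply: finj; rewrite E'' E'.
have [c0 c0c _] := cut_dart _ bd1.
(* Two hubs are never adjacent, and two ends which are not hubs agree, so this
   is the label of either end of the cut edge which is not a hub. *)
pose Lv := if is_hub (lab' (base c0)) then lab' (base (flip c0)) else lab' (base c0).
have LvP d' : cut d' -> ~~ is_hub (lab' (base d')) -> lab' (base d') = Lv.
  move=> /(cut_uniq _ _ c0c)[]-> nh; rewrite /Lv.
    by rewrite (negbTE nh).
  by case: ifP => // nh0; apply: lsep; rewrite ?nh0.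
have nhLv : ~~ is_hub Lv.
  rewrite /Lv; case: ifPn => //; case E: (lab' _) => [i|] // _.
  by apply: (@hub_neighbour_not_hub i); apply: ltarget.
pose P x X := (exists2 x', fV x' = x & X = lab' x') \/ (x = v /\ X = Lv).
have [lab labP] : exists lab, forall x, P x (lab x).
  apply: fin_all_exists => x; case: (eqVneq x v) => [->|/eqP /im_fV[x' E]].
    by exists Lv; right.
  by exists (lab' x'); left; exists x'.
have labf x : lab (fV x) = lab' x.
  by case: (labP (fV x)) => [[x' /fVinj -> //]|[/fVv]].
have labv : lab v = Lv by case: (labP v) => [[x' /fVv]|[]].
have lab_cut d' : cut d' -> lab (base (flip (fD d'))) = Lv by move/eqP->.
have lab_hub d' : is_hub (lab' (base d')) ->
    lab (base (flip (fD d'))) = lab' (base (flip d')).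
  move=> h; have [c|/cutN ->] := boolP (cut d'); last by rewrite fbase labf.
  rewrite lab_cut //; symmetry; apply: LvP (cut_flip _ c) _.
  case E: (lab' (base d')) h => [i|] // _.
  by apply: (@hub_neighbour_not_hub i); apply: ltarget.
have nvh x : is_hub (lab x) -> x <> v by move=> h E; rewrite E labv (negbTE nhLv) in h.
exists lab; split.
- move=> x y hx E; have [x' Ex] := im_fV _ (nvh _ hx).
  have hy : is_hub (lab y) by rewrite -E.
  have [y' Ey] := im_fV _ (nvh _ hy); rewrite -Ex -Ey; congr fV.
  by apply: linj; rewrite -!labf ?Ex // Ey.
- move=> d i E; have [d' Ed] : exists d', fD d' = d.
    by apply/im_fD/nvh; rewrite E.
  move: E; rewrite -Ed fbase labf => E.
  by rewrite lab_hub ?E //; apply: ltarget.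
- move=> a b ha E; have [a' Ea] := im_fD _ (nvh _ ha).
  have hb : is_hub (lab (base b)) by rewrite -E.
  have [b' Eb] := im_fD _ (nvh _ hb).
  move: ha hb E; rewrite -Ea -Eb !fbase !labf => ha hb E.
  by rewrite !lab_hub // => E'; rewrite (ldinj a' b').
- move=> i X /lex[d [dh dX]]; exists (fD d).
  by rewrite fbase labf lab_hub dh.
- have sepf d' : ~~ is_hub (lab (base (fD d'))) ->
      ~~ is_hub (lab (base (flip (fD d')))) ->
      lab (base (flip (fD d'))) = lab (base (fD d')).
    rewrite fbase labf => n1; have [c _|nc] := boolP (cut d').
      by rewrite lab_cut // (LvP _ c).
    by rewrite cutN // fbase labf; apply: lsep.
  move=> d n1 n2; have [/eqP bd|/eqP bd] := boolP (base d == v).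
    have [d' _ E] := cut_dart _ bd.
    move: n1 n2; rewrite -E flipK => n1 n2; symmetry.
    exact: sepf.
  by have [d' E] := im_fD _ bd; move: n1 n2; rewrite -E; apply: sepf.
- move=> X sigma nX sigE.
  have sig' a b : lab' a = X -> lab' b = X -> sigma (fV a) = sigma (fV b).
    apply: (lcon X (sigma \o fV)) => //= d dX fdX.
    have [c|nc] := boolP (cut d); last first.
      by rewrite -!fbase -(cutN _ nc) sigE // -?cutN // ?cutN // fbase labf.
    have LX : Lv = X by rewrite -(LvP _ c) dX.
    have cf := cut_flip _ c.
    have E1 : sigma v = sigma (base (fD d)).
      by rewrite -{1}(eqP c) sigE // ?lab_cut // fbase labf.
    have E2 : sigma v = sigma (base (fD (flip d))).
      by rewrite -{1}(eqP cf) sigE // ?lab_cut // fbase labf.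
    by rewrite -!fbase -E1 E2.
  have rep x : lab x = X -> exists2 x', lab' x' = X & sigma x = sigma (fV x').
    move=> xX; have [E|/eqP /im_fV[x' E]] := eqVneq x v; last first.
      by exists x'; rewrite -?labf E.
    have LX : Lv = X by rewrite -labv -E.
    have [d c nh] : exists2 d, cut d & ~~ is_hub (lab' (base d)).
      have [h|nh] := boolP (is_hub (lab' (base c0))); last by exists c0.
      exists (flip c0); first exact: cut_flip.
      by move: nhLv; rewrite /Lv h.
    exists (base d); first by rewrite (LvP _ c).
    rewrite E -{1}(eqP c) -fbase; apply: sigE; first by rewrite fbase labf (LvP _ c).
    by rewrite lab_cut.
  by move=> x y /rep[x' ? ->] /rep[y' ? ->]; apply: sig'.
move=> X nX; have [A [[/set0Pn[a0 a0A] Aflip Acomp] AX]] := lcore X nX.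
have Acut a : a \in A -> cut a -> Lv = X by move=> aA c; rewrite -(LvP _ c) AX.
exists ((fD @: A) :|: (@flip G @: (fD @: A))); split; first split.
- by apply/set0Pn; exists (fD a0); rewrite inE imset_f.
- move=> d /setUP[h|/imsetP[d' h ->]]; apply/setUP; last by left; rewrite flipK.
  by right; apply: imset_f.
- move=> d /setUP[/imsetP[a aA ->]|/imsetP[_ /imsetP[a aA ->] ->]].
    have [b [bA bb ba]] := Acomp a aA; exists (fD b).
    by rewrite inE imset_f // (inj_eq fDinj) !fbase bb.
  have [c|nc] := boolP (cut a).
    exists (flip (fD (flip a))); split.
    + by apply/setUP; right; apply: imset_f; apply: imset_f; apply: Aflip.
    + by rewrite (eqP c) (eqP (cut_flip _ c)).
    by rewrite (inj_eq (can_inj (@flipK G))) (inj_eq fDinj) flip_neq.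
  rewrite cutN //; have [b [bA bb ba]] := Acomp _ (Aflip _ aA); exists (fD b).
  by rewrite inE imset_f // (inj_eq fDinj) !fbase bb.
move=> d /setUP[/imsetP[a aA ->]|/imsetP[_ /imsetP[a aA ->] ->]].
  by rewrite fbase labf AX.
have [c|nc] := boolP (cut a); first by rewrite lab_cut // (Acut a).
by rewrite cutN // fbase labf AX // Aflip.
Qed.

Lemma tie_labelling_smoothing (G S : mgraph) (lab' : vertex S -> part) :
    smoothing G S -> tie_labelling lab' ->
  exists lab : vertex G -> part, tie_labelling lab.
Proof.
move=> sm; elim: sm lab' => [G0 lab'|G0 v G' G'' at_v _ IH lab'].
  by exists lab'.
move=> /IH[lab]; exact: tie_labelling_smoothing_at at_v.
Qed.

(** A leaf joins the part of its neighbour. The neighbour is not a hub, because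
    hubs have degree 3 already; here the bound on the degrees comes in. *)
Lemma tie_labelling_delete_leaf (G : mgraph) (v : vertex G)
    (lab' : vertex (delete_vertex v) -> part) :
    degree v = 1%N -> (forall x : vertex G, (degree x <= 3)%N) ->
    tie_labelling lab' ->
  exists lab : vertex G -> part, tie_labelling lab.
Proof.
move=> deg1 deg3 [linj ltarget ldinj lex lsep lcon lcore].
have /cards1P[d0 dv] : #|[set d | base d == v]| == 1%N by apply/eqP.
have bv d : (base d == v) = (d == d0) by have /setP/(_ d) := dv; rewrite !inE.
have bd0 : base d0 = v by apply/eqP; rewrite bv.
pose w := base (flip d0).
have wv : w != v by rewrite bv flip_neq.
have inV x : x != v -> x \in sub_vertices (delete_vertex v) by rewrite !inE.
have inD d : d != d0 -> d != flip d0 -> d \in sub_darts (delete_vertex v).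
  rewrite !inE !bv => -> /=; apply: contra => /eqP <-.
  by rewrite flipK.
pose w' : vertex (delete_vertex v) := exist _ w (inV _ wv).
pose x_ (x : vertex (delete_vertex v)) : vertex G := sval x.
pose d_ (d : dart (delete_vertex v)) : dart G := sval d.
have x_inj : injective x_ by exact: val_inj.
have d_inj : injective d_ by exact: val_inj.
have x_im x : x != v -> exists x', x_ x' = x.
  by move=> xv; exists (exist _ x (inV _ xv)).
have d_im d : d != d0 -> d != flip d0 -> exists d', d_ d' = d.
  by move=> h1 h2; exists (exist _ d (inD _ h1 h2)).
have x_v x : x_ x != v by case: x => x /= xv; move: (xv); rewrite !inE.
have d_base d : base (d_ d) = x_ (base d) by [].
have d_flip d : flip (d_ d) = d_ (flip d) by [].
have d_d0 d : d_ d != d0 /\ d_ d != flip d0.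
  have h e : d_ e != d0 by rewrite -bv d_base x_v.
  split=> //; apply: contra (h (flip d)) => /eqP E.
  by rewrite -d_flip E flipK.
(* A hub has three darts within the smaller graph, so the leaf would give it
   a fourth. *)
have nhw : ~~ is_hub (lab' w').
  case E: (lab' w') => [i|] //.
  have [a [aw aX]] := lex i (wing i) (eqxx _).
  have [b [bw bX]] := lex i (pod ord0) isT.
  have [c [cw cX]] := lex i (pod ord_max) isT.
  have bw' d : lab' (base d) = hub i -> base (d_ d) = w.
    move=> dE; rewrite d_base; have -> : base d = w' by apply: linj; rewrite dE.
    by [].
  have sub : [set flip d0] :|: [set d_ a; d_ b; d_ c] \subset [set d | base d == w].
    by apply/subsetP => x; rewrite !inE => /orP[|/orP[/orP[]|]] /eqP ->;
      rewrite ?bw' // eqxx.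
  have := leq_trans (subset_leq_card sub) (deg3 w).
  have ne x y : lab' (base (flip x)) <> lab' (base (flip y)) -> d_ x != d_ y.
    by move=> h; apply/eqP => /d_inj xy; rewrite xy in h.
  rewrite cardsU1 !inE ![flip d0 == _]eq_sym !negb_or !(proj2 (d_d0 _)) /=.
  rewrite -setUA cardsU1 cards2 !inE !negb_or !ne //;
    by rewrite ?aX ?bX ?cX; move/eqP.
pose P x X := (exists2 x', x_ x' = x & X = lab' x') \/ (x = v /\ X = lab' w').
have [lab labP] : exists lab, forall x, P x (lab x).
  apply: fin_all_exists => x; case: (eqVneq x v) => [->|/x_im[x' E]].
    by exists (lab' w'); right.
  by exists (lab' x'); left; exists x'.
have labf x : lab (x_ x) = lab' x.
  case: (labP (x_ x)) => [[x' /x_inj -> //]|[/eqP]].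
  by rewrite (negbTE (x_v x)).
have labv : lab v = lab' w'.
  by case: (labP v) => [[x' /eqP]|[]] //; rewrite (negbTE (x_v x')).
have labw : lab w = lab' w' by rewrite -labf.
have nvh x : is_hub (lab x) -> exists x', x_ x' = x.
  by move=> h; apply: x_im; apply: contraTneq h => ->; rewrite labv.
have nhd d : is_hub (lab (base d)) -> exists d', d_ d' = d.
  move=> h; apply: d_im; apply: contraTneq h => ->; last by rewrite labw.
  by rewrite bd0 labv.
exists lab; split.
- move=> x y hx E; have [x' Ex] := nvh _ hx.
  have hy : is_hub (lab y) by rewrite -E.
  have [y' Ey] := nvh _ hy; rewrite -Ex -Ey; congr x_.
  by apply: linj; rewrite -!labf ?Ex // Ey.
- move=> d i E; have [d' Ed] : exists d', d_ d' = d by apply: nhd; rewrite E.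
  by move: E; rewrite -Ed d_flip !d_base !labf; apply: ltarget.
- move=> a b ha E; have [a' Ea] := nhd _ ha.
  have hb : is_hub (lab (base b)) by rewrite -E.
  have [b' Eb] := nhd _ hb.
  move: ha hb E; rewrite -Ea -Eb !d_flip !d_base !labf => ha hb E E'.
  by rewrite (ldinj a' b').
- move=> i X /lex[d [dh dX]]; exists (d_ d).
  by rewrite d_flip !d_base !labf.
- move=> d; have [->|h1] := eqVneq d d0; first by rewrite bd0 labv labw.
  have [->|h2] := eqVneq d (flip d0); first by rewrite flipK bd0 labv labw.
  by have [d' <-] := d_im _ h1 h2; rewrite d_flip !d_base !labf; apply: lsep.
- move=> X sigma nX sigE.
  have sig' a b : lab' a = X -> lab' b = X -> sigma (x_ a) = sigma (x_ b).
    apply: (lcon X (sigma \o x_)) => // d dX fdX.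
    by apply: (sigE (d_ d)); rewrite ?d_flip d_base labf.
  have rep x : lab x = X -> exists2 x', lab' x' = X & sigma x = sigma (x_ x').
    move=> xX; have [E|/x_im[x' E]] := eqVneq x v; last first.
      by exists x'; rewrite -?labf E.
    have wX : lab' w' = X by rewrite -labv -E.
    by exists w' => //; rewrite E -bd0 -sigE // ?bd0 ?labv ?labw.
  by move=> x y /rep[x' ? ->] /rep[y' ? ->]; apply: sig'.
move=> X /lcore[A [coreA AX]]; exists (d_ @: A); split.
  by apply: core_map coreA => // d d'; rewrite !d_base => ->.
by move=> _ /imsetP[d dA ->]; rewrite d_base labf AX.
Qed.

Lemma degree_delete_vertex (G : mgraph) (v : vertex G) (x : vertex (delete_vertex v)) :
  (degree x <= degree (sval x : vertex G))%N.
Proof.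
rewrite /degree -(card_imset _ (val_inj : injective (val : dart (delete_vertex v) -> _))).
apply: subset_leq_card; apply/subsetP => _ /imsetP[d + ->].
by rewrite !inE => /eqP <-.
Qed.

Lemma tie_labelling_prune (G C : mgraph) (lab' : vertex C -> part) :
    prune G C -> (forall x : vertex G, (degree x <= 3)%N) ->
    tie_labelling lab' ->
  exists lab : vertex G -> part, tie_labelling lab.
Proof.
move=> pr; elim: pr lab' => [G0|G0 v G' deg1 _ IH] lab' deg3; first by exists lab'.
move=> /IH[|lab]; last exact: tie_labelling_delete_leaf.
by move=> x; apply: leq_trans (degree_delete_vertex x) (deg3 _).
Qed.

Lemma skeleton_tie_labelling R (G D S : mgraph) :
    tie_fighter R G -> graph_iso G S -> is_skeleton D S ->
    (forall x : vertex D, (degree x <= 3)%N) ->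
  exists lab : vertex D -> part, tie_labelling lab.
Proof.
move=> /tie_fighter_labelling[lab labP] iso [C [pr _ sm _]] deg3.
have [labS labSP] := tie_labelling_iso iso labP.
have [labC labCP] := tie_labelling_smoothing sm labSP.
exact: tie_labelling_prune pr deg3 labCP.
Qed.

From mathcomp Require Import all_classical all_analysis.
Import numFieldNormedType.Exports.

Local Open Scope ring_scope.
Local Open Scope classical_set_scope.

(** * Orientation and barycentric coordinates *)

(** Twice the signed area of the triangle pqr: its sign tells on which side of
    the line pq the point r lies. *)
Definition orient (A : comNzRingType) (p q r : 'rV[A]_2) : A :=
  (q 0 0 - p 0 0) * (r 0 1 - p 0 1) - (q 0 1 - p 0 1) * (r 0 0 - p 0 0).

Section Orient.
Variable A : comNzRingType.
Implicit Types p q r z : 'rV[A]_2.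

Lemma orient_rot p q r : orient q r p = orient p q r.
Proof. by rewrite /orient; ring. Qed.

Lemma orientC p q r : orient q p r = - orient p q r.
Proof. by rewrite /orient; ring. Qed.

Lemma orient_xx p q : orient p p q = 0.
Proof. by rewrite /orient; ring. Qed.

Lemma orient_xyx p q : orient p q p = 0.
Proof. by rewrite /orient; ring. Qed.

Lemma orient_xyy p q : orient p q q = 0.
Proof. by rewrite /orient; ring. Qed.

Lemma orient_sum p q r z :
  orient q r z + orient r p z + orient p q z = orient p q r.
Proof. by rewrite /orient; ring. Qed.

End Orient.

Section Plane.
Variable R : realType.
Implicit Types (p q r z o : 'rV[R]_2) (D : set 'rV[R]_2).

(** As a function of its last argument [orient] is affine; hence it is compatible
    with convex combinations. *)
Lemma orient_comb p q n (w : 'I_n -> R) (x : 'I_n -> 'rV[R]_2) :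
  \sum_i w i = 1 -> orient p q (\sum_i w i *: x i) = \sum_i w i * orient p q (x i).
Proof.
move=> w1.
transitivity (\sum_i ((q 0 0 - p 0 0) * (w i * x i 0 1 - w i * p 0 1)
                    - (q 0 1 - p 0 1) * (w i * x i 0 0 - w i * p 0 0))).
  rewrite sumrB -!mulr_sumr !sumrB -!mulr_suml w1 /orient !summxE.
  by rewrite !mul1r; under eq_bigr do rewrite mxE;
     under [in X in _ - X = _]eq_bigr do rewrite mxE.
by apply: eq_bigr => i _; rewrite /orient; ring.
Qed.

Lemma orient_comb2 p q x y (t : R) :
  orient p q (t *: x + (1 - t) *: y) = t * orient p q x + (1 - t) * orient p q y.
Proof. by rewrite /orient !mxE; ring. Qed.

Lemma orient_comb3 p q r (x y w : R) : x + y + w = 1 ->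
  orient p q (x *: p + y *: q + w *: r) = w * orient p q r.
Proof.
move=> xyw; have -> : x = 1 - y - w by rewrite -xyw; ring.
by rewrite /orient !mxE; ring.
Qed.

Lemma orient_extrapolate p q y r (t : R) :
  orient p q (y + t *: (y - r)) = orient p q y + t * (orient p q y - orient p q r).
Proof. by rewrite /orient !mxE; ring. Qed.

(** The barycentric coordinate of z at p in the triangle pqr; those at q and r
    are [bary q r p z] and [bary r p q z]. *)
Definition bary p q r z : R := orient q r z / orient p q r.

Lemma bary_sum p q r z : orient p q r != 0 ->
  bary p q r z + bary q r p z + bary r p q z = 1.
Proof.
move=> D0; rewrite /bary (orient_rot q r p) !(orient_rot p q r) -!mulrDl.
by rewrite orient_sum divff.
Qed.

Lemma bary_decomp p q r z : orient p q r != 0 ->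
  z = bary p q r z *: p + bary q r p z *: q + bary r p q z *: r.
Proof.
move=> D0; rewrite /bary (orient_rot q r p) !(orient_rot p q r).
apply/rowP => i; rewrite !mxE; case: i => [[|[|//]] ilt].
  have -> : Ordinal ilt = 0 by apply: val_inj.
  by move: D0; rewrite /orient => D0; field.
have -> : Ordinal ilt = 1 by apply: val_inj.
by move: D0; rewrite /orient => D0; field.
Qed.

Lemma bary_flip p q r z : bary p r q z = bary p q r z.
Proof.
rewrite /bary -(orient_rot p q r) -(orient_rot p r q).
by rewrite (orientC q r z) (orientC q r p) invrN mulrNN.
Qed.

Definition segment_closed D := forall x y (t : R),
  D x -> D y -> 0 <= t <= 1 -> D (t *: x + (1 - t) *: y).

Lemma convex_hull_convex (V : lmodType R) (A : set V) x y (t : R) :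
  convex_hull A x -> convex_hull A y -> 0 <= t <= 1 ->
  convex_hull A (t *: x + (1 - t) *: y).
Proof.
move=> [n [w [p [w0 pA w1 ->]]]] [m [u [q [u0 qA u1 ->]]]] /andP[t0 t1].
have sl i : fintype.split (lshift m i) = inl i := unsplitK (inl i).
have sr i : fintype.split (rshift n i) = inr i := unsplitK (inr i).
exists (n + m)%N, (fun k => match fintype.split k with inl i => t * w i | inr j => (1 - t) * u j end),
  (fun k => match fintype.split k with inl i => p i | inr j => q j end); split.
- by move=> k; case: fintype.split => i; rewrite mulr_ge0 ?subr_ge0.
- by move=> k; case: fintype.split.
- transitivity (\sum_i t * w i + \sum_i (1 - t) * u i).
    by rewrite big_split_ord; congr (_ + _); apply: eq_bigr => i _; rewrite (sl, sr).
  by rewrite -!mulr_sumr w1 u1; ring.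
rewrite big_split_ord; congr (_ + _); rewrite scaler_sumr; apply: eq_bigr => i _.
  by rewrite sl scalerA.
by rewrite sr scalerA.
Qed.

Lemma hull_mem (s : {fset Z2}) v : v \in s -> lattice_hull s (embed R v).
Proof.
move=> vs; exists 1%N, (fun=> 1), (fun=> embed R v); split.
- by move=> _; rewrite ler01.
- by move=> _; exists v.
- by rewrite big_ord1.
by rewrite big_ord1 scale1r.
Qed.

Lemma hull_orient_ge0 (p q : 'rV[R]_2) (s : {fset Z2}) :
    (forall v, v \in s -> 0 <= orient p q (embed R v)) ->
  forall z, lattice_hull s z -> 0 <= orient p q z.
Proof.
move=> sge z [n [w [x [w0 xs w1 ->]]]]; rewrite orient_comb //.
by apply: sumr_ge0 => i _; apply: mulr_ge0 => //; have [v vs <-] := xs i; apply: sge.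
Qed.

Lemma hull_orient_eq0 (p q : 'rV[R]_2) (s : {fset Z2}) :
    (forall v, v \in s -> orient p q (embed R v) = 0) ->
  forall z, lattice_hull s z -> orient p q z = 0.
Proof.
move=> seq z zs; apply/le_anti/andP; split; last first.
  by apply: hull_orient_ge0 zs => v /seq ->.
rewrite -oppr_ge0 -orientC; apply: hull_orient_ge0 zs => v /seq v0.
by rewrite orientC v0 oppr0.
Qed.

Lemma hull3_comb (p q r : Z2) (x y w : R) :
    0 <= x -> 0 <= y -> 0 <= w -> x + y + w = 1 ->
  lattice_hull [fset p; q; r]%fset (x *: embed R p + y *: embed R q + w *: embed R r).
Proof.
move=> x0 y0 w0 xyw.
exists 3%N, (fun i : 'I_3 => nth 0 [:: x; y; w] i),
  (fun i : 'I_3 => embed R (nth p [:: p; q; r] i)); split.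
- by case=> [[|[|[|]]]].
- by case=> [[|[|[|]]]] //= _; (eexists; last reflexivity); rewrite /= !inE eqxx ?orbT.
- by rewrite !big_ord_recl big_ord0 addr0 addrA.
by rewrite !big_ord_recl big_ord0 addr0 addrA.
Qed.

Lemma mem_hull3 (p q r : Z2) z :
    orient (embed R p) (embed R q) (embed R r) != 0 ->
    0 <= bary (embed R p) (embed R q) (embed R r) z ->
    0 <= bary (embed R q) (embed R r) (embed R p) z ->
    0 <= bary (embed R r) (embed R p) (embed R q) z ->
  lattice_hull [fset p; q; r]%fset z.
Proof.
by move=> D0 bp bq br; rewrite (bary_decomp z D0); apply: hull3_comb; rewrite ?bary_sum.
Qed.

(** * Interior points of convex sets *)

Lemma interiorP D z : interior D z <->
  exists2 e : R, 0 < e & forall y : 'rV[R]_2, (forall j, `|z 0 j - y 0 j| < e) -> D y.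
Proof.
split=> [/nbhs_ballP[e e0 eD]|[e e0 eD]].
  by exists e => // y zy; apply: eD; split=> // i j; rewrite ord1; apply: zy.
by apply/nbhs_ballP; exists e => //= y [_ zy]; apply: eD => j; apply: zy.
Qed.

Lemma interior_along D z d : interior D z ->
  exists2 del : R, 0 < del & forall eps, 0 < eps < del -> D (z + eps *: d).
Proof.
move=> /interiorP[e e0 eD]; pose c := 1 + `|d 0 0| + `|d 0 1|.
have d0 := normr_ge0 (d 0 0); have d1 := normr_ge0 (d 0 1).
have c0 : 0 < c by rewrite /c; lra.
exists (e / c) => [|eps /andP[eps0 epsc]]; first by rewrite divr_gt0.
apply: eD => j; rewrite !mxE opprD addNKr normrN normrM gtr0_norm //.
have dc : `|d 0 j| < c.
  rewrite /c; case: j => [[|[|//]] jlt].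
    have -> : Ordinal jlt = 0 by apply: val_inj.
    by lra.
  have -> : Ordinal jlt = 1 by apply: val_inj.
  by lra.
have : eps * `|d 0 j| <= eps * c by rewrite ler_wpM2l // ltW.
have : eps * c < e by rewrite -ltr_pdivlMr.
by lra.
Qed.

Lemma orient_gt0_near p q z : 0 < orient p q z ->
  exists2 e : R, 0 < e &
    forall y : 'rV[R]_2, (forall j, `|z 0 j - y 0 j| < e) -> 0 < orient p q y.
Proof.
move=> z0; pose a := `|q 0 0 - p 0 0|; pose b := `|q 0 1 - p 0 1|.
have ab : 0 < 1 + a + b by rewrite ltr_pwDl ?ltr_pwDl ?normr_ge0 ?ltr01.
exists (orient p q z / (1 + a + b)) => [|y h]; first by rewrite divr_gt0.
have h0 := h 0; have h1 := h 1.
have -> : orient p q y = orient p q z - ((q 0 0 - p 0 0) * (z 0 1 - y 0 1)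
                                   - (q 0 1 - p 0 1) * (z 0 0 - y 0 0)).
  by rewrite /orient; ring.
rewrite subr_gt0; apply: le_lt_trans (ler_norm _) _.
apply: le_lt_trans (ler_normB _ _) _; rewrite !normrM -/a -/b.
set e := _ / _ in h0 h1.
have -> : orient p q z = (1 + a + b) * e by rewrite mulrC divfK // gt_eqF.
have e0 : 0 < e by rewrite divr_gt0.
have : a * `|z 0 1 - y 0 1| <= a * e by rewrite ler_wpM2l ?normr_ge0 // ltW.
have : b * `|z 0 0 - y 0 0| <= b * e by rewrite ler_wpM2l ?normr_ge0 // ltW.
by lra.
Qed.

(** A point with positive barycentric coordinates keeps them under small
    perturbations. *)
Lemma interior_hull3 D (p q r : Z2) z :
    lattice_hull [fset p; q; r]%fset `<=` D ->
    0 < bary (embed R p) (embed R q) (embed R r) z ->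
    0 < bary (embed R q) (embed R r) (embed R p) z ->
    0 < bary (embed R r) (embed R p) (embed R q) z ->
  interior D z.
Proof.
wlog D0 : p q r / 0 < orient (embed R p) (embed R q) (embed R r).
  move=> wl sD bp bq br.
  have D0 : orient (embed R p) (embed R q) (embed R r) != 0.
    by apply: contraTneq bp => D0; rewrite /bary D0 invr0 mulr0 ltxx.
  have [Dpos|Dneg|E] := ltgtP (orient (embed R p) (embed R q) (embed R r)) 0.
  - apply: (wl p r q).
    + by rewrite -orient_rot orientC oppr_gt0 orient_rot.
    + suff -> : [fset p; r; q]%fset = [fset p; q; r]%fset by [].
      by rewrite -!fsetUA [([fset r] `|` _)%fset]fsetUC.
    + by rewrite bary_flip.
    + by rewrite bary_flip.
    + by rewrite bary_flip.
  - exact: (wl p q r).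
  - by rewrite E eqxx in D0.
move=> sD; rewrite /bary (orient_rot (embed R q)) !(orient_rot (embed R p)).
rewrite !pmulr_lgt0 ?invr_gt0 // => bp bq br.
have [e1 e10 near1] := orient_gt0_near bp.
have [e2 e20 near2] := orient_gt0_near bq.
have [e3 e30 near3] := orient_gt0_near br.
apply/interiorP; exists (Num.min e1 (Num.min e2 e3)); first by rewrite !lt_min e10 e20.
move=> y zy; apply: sD.
have yp : 0 < orient (embed R q) (embed R r) y.
  by apply: near1 => j; have := zy j; rewrite !lt_min => /and3P[].
have yq : 0 < orient (embed R r) (embed R p) y.
  by apply: near2 => j; have := zy j; rewrite !lt_min => /and3P[].
have yr : 0 < orient (embed R p) (embed R q) y.
  by apply: near3 => j; have := zy j; rewrite !lt_min => /and3P[].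
apply: mem_hull3; first by rewrite gt_eqF.
all: by rewrite /bary ?(orient_rot (embed R q)) ?(orient_rot (embed R p)) divr_ge0 // ltW.
Qed.

(** The image of a ball around o under the homothety of centre y lies in D. *)
Lemma interior_comb D o y (t : R) : segment_closed D ->
  interior D o -> D y -> 0 < t <= 1 -> interior D (t *: o + (1 - t) *: y).
Proof.
move=> cD /interiorP[e e0 oD] yD /andP[t0 t1].
apply/interiorP; exists (t * e) => [|z zb]; first by rewrite mulr_gt0.
have -> : z = t *: (o + t^-1 *: (z - (t *: o + (1 - t) *: y))) + (1 - t) *: y.
  rewrite scalerDr scalerA divff ?gt_eqF // scale1r; apply/rowP => i.
  by rewrite !mxE; ring.
apply: cD => //; last by rewrite t1 ltW.
apply: oD => j; have := zb j; rewrite !mxE.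
set c := t * o 0 j + (1 - t) * y 0 j; move=> h.
have -> : o 0 j - (o 0 j + t^-1 * (z 0 j - c)) = t^-1 * (c - z 0 j) by ring.
by rewrite normrM gtr0_norm ?invr_gt0 // mulrC ltr_pdivrMr // mulrC.
Qed.

(** The form in which interior points are produced below: a combination in which
    an interior point occurs with positive weight. *)
Lemma interior_comb3 D o y z a (w0 w1 w2 : R) : segment_closed D ->
    interior D o -> D y -> D z -> 0 < w0 -> 0 <= w1 -> 0 <= w2 ->
    (w0 + w1 + w2) *: a = w0 *: o + w1 *: y + w2 *: z ->
  interior D a.
Proof.
move=> cD oD yD zD w00 w10 w20 E.
have W0 : 0 < w0 + w1 + w2 by rewrite -addrA ltr_pwDl ?addr_ge0.
have {}E : a = (w0 / (w0 + w1 + w2)) *: o + (w1 / (w0 + w1 + w2)) *: y +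
                (w2 / (w0 + w1 + w2)) *: z.
  rewrite ![_ / _]mulrC -!scalerA -!scalerDr -E scalerA mulVf ?scale1r //.
  by rewrite gt_eqF.
have [S0|S0] := eqVneq (w1 + w2) 0.
  have w1E : w1 = 0 by lra.
  have w2E : w2 = 0 by lra.
  by rewrite E w1E w2E !mul0r !scale0r !addr0 divff ?gt_eqF // scale1r.
have Sp : 0 < w1 + w2 by rewrite lt0r S0 addr_ge0.
have -> : a = (w0 / (w0 + w1 + w2)) *: o + (1 - w0 / (w0 + w1 + w2)) *:
    ((w1 / (w1 + w2)) *: y + (1 - w1 / (w1 + w2)) *: z).
  rewrite E; apply/rowP => i; rewrite !mxE.
  by field; rewrite !gt_eqF.
apply: interior_comb => //.
  apply: cD => //; rewrite divr_ge0 ?addr_ge0 // ler_pdivrMr // mul1r.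
  by rewrite lerDl.
by rewrite divr_gt0 // ler_pdivrMr // mul1r -addrA lerDl addr_ge0.
Qed.

End Plane.

Section Embed.
Variable R : realType.

Lemma orient_embed (p q r : Z2) :
  orient (embed R p) (embed R q) (embed R r) = (orient p q r)%:~R.
Proof. by rewrite /orient !mxE !rmorphB !rmorphM !rmorphB. Qed.

Lemma det_2x2 (A : comNzRingType) (M : 'M[A]_2) :
  \det M = M 0 0 * M 1 1 - M 0 1 * M 1 0.
Proof.
rewrite (expand_det_row _ 0) !big_ord_recl big_ord0 addr0 /cofactor !det_mx11 !mxE.
have e1 : lift (0 : 'I_2) (0 : 'I_1) = 1 by apply: val_inj.
have e0 : lift (1 : 'I_2) (0 : 'I_1) = 0 by apply: val_inj.
by rewrite !e1 !e0 /= expr0 expr1; ring.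
Qed.

Lemma triangle_area_orient (p q r : Z2) :
  triangle_area R p q r = `|(orient p q r)%:~R| / 2.
Proof.
rewrite /triangle_area -orient_embed; congr (`| _ | / 2).
have e0 : (0 : 'I_2) = lshift 1 (0 : 'I_1) by apply: val_inj.
have e1 : (1 : 'I_2) = rshift 1 (0 : 'I_1) by apply: val_inj.
rewrite det_2x2.
have up (a b : 'rV[R]_2) j : col_mx a b (0 : 'I_2) j = a 0 j by rewrite e0; apply: col_mxEu.
have dn (a b : 'rV[R]_2) j : col_mx a b (1 : 'I_2) j = b 0 j by rewrite {1}e1; apply: col_mxEd.
by rewrite !up !dn /orient !mxE.
Qed.
End Embed.

Section Wedges.
Variable R : realType.
Implicit Types (p q r z o : 'rV[R]_2) (D : set 'rV[R]_2).

Definition centroid p q r : 'rV[R]_2 := 3^-1 *: (p + q + r).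

Lemma bary_decomp_affine p q r z : orient p q r != 0 ->
  z = bary p q r z *: p + (1 - bary p q r z - bary r p q z) *: q + bary r p q z *: r.
Proof.
move=> D0; rewrite -(bary_sum z D0) [z in LHS](bary_decomp z D0).
by congr (_ + _ *: _ + _); ring.
Qed.

(** If pqr and pqr' lie on different sides of pq, then q cannot be between p and
    another point z of D on the line pq without being interior: it is surrounded
    by r, r', p and z. *)
Lemma interior_beyond_edge D p q r r' z : segment_closed D ->
    interior D (centroid p q r) -> D p -> D r' -> D z ->
    orient p q r != 0 -> bary r p q r' < 0 ->
    bary r p q z = 0 -> bary p q r z < 0 ->
  interior D q.
Proof.
move=> cD oD pD r'D zD D0.
have := bary_decomp_affine r' D0; have := bary_decomp_affine z D0.
move: (bary r p q r') (bary p q r r') (bary r p q z) (bary p q r z) => c a b x.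
move=> zE r'E c0 b0 x0; rewrite b0 in zE.
have [le0|gt0] := leP 0 (a - c).
  apply: (@interior_comb3 _ D _ r' z q (- 3 * c) 1 ((a - c) / - x) cD oD r'D zD).
  - lra.
  - by [].
  - by rewrite divr_ge0 // oppr_ge0 ltW.
  rewrite zE r'E; apply/rowP => i; rewrite !mxE; field; rewrite ?oppr_eq0 lt_eqF //.
apply: (@interior_comb3 _ D _ r' p q (- 3 * c) 1 (c - a) cD oD r'D pD).
- lra.
- by [].
- lra.
by rewrite r'E; apply/rowP => i; rewrite !mxE; field.
Qed.

(** The point q is a positive combination of the triangle pqr and of z, which
    lies in the angle opposite to the one of the triangle at q. *)
Lemma interior_opposite_wedge D p q r z : segment_closed D ->
    interior D (centroid p q r) -> D p -> D r -> D z ->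
    orient p q r != 0 -> bary p q r z < 0 -> bary r p q z < 0 ->
  interior D q.
Proof.
move=> cD oD pD rD zD D0.
have := bary_decomp_affine z D0.
move: (bary r p q z) (bary p q r z) => c a.
move=> zE a0 c0.
have [le0|gt0] := leP a c.
  apply: (@interior_comb3 _ D _ z p q (- 3 * c) 1 (c - a) cD oD zD pD).
  - lra.
  - by [].
  - lra.
  by rewrite zE; apply/rowP => i; rewrite !mxE; field.
apply: (@interior_comb3 _ D _ z r q (- 3 * a) 1 (a - c) cD oD zD rD).
- lra.
- by [].
- lra.
by rewrite zE; apply/rowP => i; rewrite !mxE; field.
Qed.

(** In coordinates with origin c and basis a, b: if y is beyond the line ab but not
    above the ray from c through a, then a is a convex combination of y, b and c
    in which y has positive weight. *)
Lemma interior_below_ray D a b c y : segment_closed D ->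
    interior D y -> D b -> D c -> orient a c b != 0 ->
    1 < bary a c b y + bary b a c y -> bary b a c y <= 0 ->
  interior D a.
Proof.
move=> cD yD bD cinD D0; have := bary_decomp_affine y D0.
move: (bary a c b y) (bary b a c y) => u v yE uv v0.
apply: (@interior_comb3 _ D _ b c a 1 (- v) (u + v - 1) cD yD bD cinD).
- by [].
- lra.
- lra.
by rewrite yE; apply/rowP => i; rewrite !mxE; ring.
Qed.

(** In the same coordinates, with y and z on different sides of the ray from c
    through a and both with first coordinate at least 1, a lies in the triangle
    cyz. *)
Lemma interior_across_ray D a b c y z : segment_closed D ->
    interior D y -> D z -> D c -> orient a c b != 0 ->
    1 <= bary a c b y -> 0 < bary b a c y -> 1 <= bary a c b z -> bary b a c z < 0 ->
  interior D a.
Proof.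
move=> cD yD zD cinD D0; have := bary_decomp_affine y D0; have := bary_decomp_affine z D0.
move: (bary a c b y) (bary b a c y) (bary a c b z) (bary b a c z) => u v s t.
move=> zE yE u1 v1 s1 t0.
apply: (@interior_comb3 _ D _ z c a (- t) v (- t * (u - 1) + v * (s - 1)) cD yD zD cinD).
- lra.
- lra.
- by rewrite addr_ge0 // mulr_ge0 //; lra.
by rewrite yE zE; apply/rowP => i; rewrite !mxE; ring.
Qed.

End Wedges.

(** * Unimodular triangulations *)

Section FsetTriples.
Variable K : choiceType.
Implicit Types p q r : K.

Lemma fset3_swap12 p q r : [fset q; p; r]%fset = [fset p; q; r]%fset.
Proof. by rewrite [([fset q] `|` _)%fset]fsetUC. Qed.

Lemma fset3_rot p q r : [fset q; r; p]%fset = [fset p; q; r]%fset.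
Proof. by rewrite [LHS]fsetUC fsetUA. Qed.

Lemma fset3_swap23 p q r : [fset p; r; q]%fset = [fset p; q; r]%fset.
Proof. by rewrite -fset3_rot fset3_swap12 fset3_rot fset3_swap12 fset3_rot. Qed.

Lemma in_fset3 p q r x :
  (x \in [fset p; q; r]%fset) = [|| x == p, x == q | x == r].
Proof. by rewrite !inE orbA. Qed.

End FsetTriples.

Lemma sum_indicator (I : Type) (a : pred I) (r : seq I) :
  (\sum_(i <- r) a i = size (seq.filter a r))%N.
Proof.
by rewrite size_filter -sum1_count [RHS]big_mkcond; apply: eq_bigr => i _; case: (a i).
Qed.

Section Triangulation.
Variable R : realType.
Variables (D : set 'rV[R]_2) (T : {fset {fset Z2}}).
Hypothesis convexD : segment_closed D.
Hypothesis triT : unimodular_triangulation D T.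
Local Notation e := (embed R).

Lemma tri_exists t : t \in T ->
  exists p q r : Z2, t = [fset p; q; r]%fset /\ `|orient p q r| = 1.
Proof.
case: triT => /(_ t) h _ _ /h[p [q [r [-> area]]]]; exists p, q, r; split=> //.
move: area; rewrite triangle_area_orient => /(divIf (lt0r_neq0 (ltr0Sn _ 1))).
by rewrite -intr_norm -[1]/(1%:~R) => /eqP; rewrite eqr_int => /eqP.
Qed.

Lemma orient_neq0_uniq (p q r : Z2) : orient p q r != 0 -> [/\ p != q, q != r & p != r].
Proof.
move=> D0; split; apply: contraNneq D0 => ->.
- by rewrite orient_xx.
- by rewrite orient_xyy.
by rewrite orient_xyx.
Qed.

Lemma norm1_neq0 (x : int) : `|x| = 1 -> x != 0.
Proof. by move=> x1; apply: contraPneq x1 => ->; rewrite normr0. Qed.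

Lemma norm1_sign (x : int) : `|x| = 1 -> x = 1 \/ x = -1.
Proof. by case: (ger0P x) => _ <-; [left | right; rewrite opprK]. Qed.

Lemma tri_edge t p q : t \in T -> p \in t -> q \in t -> p != q ->
  exists r, t = [fset p; q; r]%fset /\ `|orient p q r| = 1.
Proof.
move=> /tri_exists[a [b [c [-> n1]]]]; rewrite !in_fset3.
have Eb : `|orient b c a| = 1 by rewrite orient_rot.
have Ec : `|orient c a b| = 1 by rewrite orient_rot.
have Ea' : `|orient b a c| = 1 by rewrite orientC normrN.
have Eb' : `|orient c b a| = 1 by rewrite orientC normrN.
have Ec' : `|orient a c b| = 1 by rewrite orientC normrN.
move=> /or3P[] /eqP -> /or3P[] /eqP ->; rewrite ?eqxx // => _.
- by exists c.
- by exists b; rewrite fset3_swap23.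
- by exists c; rewrite fset3_swap12.
- by exists a; rewrite -fset3_rot.
- by exists b; rewrite fset3_rot.
- by exists a; rewrite fset3_rot fset3_swap23.
Qed.

Lemma tri_vertex t p : t \in T -> p \in t ->
  exists q r, t = [fset p; q; r]%fset /\ `|orient p q r| = 1.
Proof.
move=> tT pt; have [a [b [c [tE /norm1_neq0 /orient_neq0_uniq[ab bc ac]]]]] := tri_exists tT.
have [q qt qp] : exists2 q, q \in t & p != q.
  have [pa|] := eqVneq p a; last by exists a; rewrite // tE in_fset3 eqxx.
  by exists b; rewrite ?pa // tE in_fset3 eqxx orbT.
by have [r rP] := tri_edge tT pt qt qp; exists q, r.
Qed.

Lemma tri_subD t : t \in T -> lattice_hull t `<=` D.
Proof. by case: triT => _ <- _ tT z zt; exists t. Qed.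

Lemma vertexD t p : t \in T -> p \in t -> D (e p).
Proof. by move=> tT pt; apply: (tri_subD tT); apply: hull_mem. Qed.

Lemma orient_embed_neq0 (p q r : Z2) : orient p q r != 0 ->
  orient (e p) (e q) (e r) != 0.
Proof. by rewrite orient_embed intr_eq0. Qed.

(** Two triangles meet in a common face, and a point of this face with nonzero
    barycentric coordinate at p shows that p belongs to the face. *)
Lemma shared_vertex s t (p q r : Z2) z : s \in T -> t \in T ->
    s = [fset p; q; r]%fset -> lattice_hull s z -> lattice_hull t z ->
    orient (e q) (e r) z != 0 ->
  p \in t.
Proof.
move=> sT tT sE zs zt; case: triT => _ _ /(_ s t sT tT)[f [fs ft fE]].
have zf : lattice_hull f z by rewrite -fE.
apply: contraR => pt; apply/eqP; apply: hull_orient_eq0 zf => v vf.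
have vs := fsubsetP fs _ vf; have vt := fsubsetP ft _ vf.
move: vs; rewrite sE in_fset3 => /or3P[] /eqP vE.
- by rewrite -vE vt in pt.
- by rewrite vE orient_xyx.
by rewrite vE orient_xyy.
Qed.

Lemma vertex_in_hull s t p : s \in T -> t \in T -> p \in s ->
  lattice_hull t (e p) -> p \in t.
Proof.
move=> sT tT ps pt; have [q [r [sE /norm1_neq0 D0]]] := tri_vertex sT ps.
apply: (shared_vertex sT tT sE _ pt); first exact: hull_mem.
by rewrite orient_embed_neq0 // orient_rot.
Qed.

(** Triangles on the same side of a common edge overlap near the middle of that
    edge. *)
Lemma same_side_eq s t (p q r r' : Z2) : s \in T -> t \in T ->
    s = [fset p; q; r]%fset -> t = [fset p; q; r']%fset ->
    `|orient p q r| = 1 -> orient p q r' = orient p q r ->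
  s = t.
Proof.
move=> sT tT sE tE n1 eqD.
have D0 := norm1_neq0 n1; have [pq qr pr] := orient_neq0_uniq D0.
have D0' : orient p q r' != 0 by rewrite eqD.
suff : r \in t.
  rewrite sE tE in_fset3 eq_sym (negbTE pr) eq_sym (negbTE qr) /=.
  by move/eqP->.
(* The point z lies close to the middle of the edge pq, inside both triangles. *)
pose k : R := bary (e p) (e q) (e r) (e r').
pose eps : R := (1 + 2 * `|k|)^-1.
have k0 : 0 <= `|k| by [].
have c0 : 0 < 1 + 2 * `|k| by lra.
have eps0 : 0 < eps by rewrite invr_gt0.
have epsk : eps + 2 * (`|k| * eps) = 1.
  rewrite mulrA -[X in X + _]mul1r -mulrDl mulfV // gt_eqF //.
have k1 : k * eps <= `|k| * eps by rewrite ler_pM2r // ler_norm.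
have k2 : - (`|k| * eps) <= k * eps by rewrite -mulNr ler_pM2r // lerNl -normrN ler_norm.
have De := orient_embed_neq0 D0; have De' := orient_embed_neq0 D0'.
have r'E := bary_decomp_affine (e r') De.
have br' : bary (e r) (e p) (e q) (e r') = 1.
  by rewrite /bary !orient_embed eqD (orient_rot q) (orient_rot p) divff // intr_eq0.
rewrite br' -/k in r'E.
pose z : 'rV[R]_2 := ((1 - eps) / 2) *: e p + ((1 - eps) / 2) *: e q + eps *: e r'.
have zE : z = ((1 - eps) / 2 + k * eps) *: e p + ((1 - eps) / 2 - k * eps) *: e q + eps *: e r.
  by rewrite /z r'E; apply/rowP => i; rewrite !mxE; field.
have zs : lattice_hull s z by rewrite zE sE; apply: hull3_comb; lra.
have zt : lattice_hull t z by rewrite tE; apply: hull3_comb; lra.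
rewrite (fset3_rot r p q) in sE.
apply: (shared_vertex sT tT sE zs zt); rewrite zE orient_comb3; last by lra.
by rewrite mulf_neq0 // gt_eqF.
Qed.

(** Two of the three triangles lie on the same side of the edge. *)
Lemma edge_triangles_le2 s t u p q : s \in T -> t \in T -> u \in T ->
    p != q -> p \in s -> q \in s -> p \in t -> q \in t -> p \in u -> q \in u ->
  [|| s == t, s == u | t == u].
Proof.
move=> sT tT uT pq ps qs pt qt pu qu.
have [r [sE rn]] := tri_edge sT ps qs pq.
have [r' [tE rn']] := tri_edge tT pt qt pq.
have [r'' [uE rn'']] := tri_edge uT pu qu pq.
have [E|E] : orient p q r' = orient p q r \/ orient p q r' = - orient p q r.
  by case: (norm1_sign rn) => ->; case: (norm1_sign rn') => ->; rewrite ?opprK; auto.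
  by rewrite (same_side_eq sT tT sE tE rn E) eqxx.
have [E'|E'] : orient p q r'' = orient p q r \/ orient p q r'' = - orient p q r.
  by case: (norm1_sign rn) => ->; case: (norm1_sign rn'') => ->; rewrite ?opprK; auto.
  by rewrite (same_side_eq sT uT sE uE rn E') eqxx orbT.
by rewrite (same_side_eq tT uT tE uE rn') ?E // eqxx !orbT.
Qed.

Lemma edge_opposite_sides s t p q r r' : s \in T -> t \in T -> s != t ->
    s = [fset p; q; r]%fset -> t = [fset p; q; r']%fset ->
    `|orient p q r| = 1 -> `|orient p q r'| = 1 ->
  orient p q r' = - orient p q r.
Proof.
move=> sT tT st sE tE n1 n1'.
have [E|//] : orient p q r' = orient p q r \/ orient p q r' = - orient p q r.
  by case: (norm1_sign n1) => ->; case: (norm1_sign n1') => ->; rewrite ?opprK; auto.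
by rewrite (same_side_eq sT tT sE tE n1 E) eqxx in st.
Qed.

Lemma interior_centroid (p q r : Z2) : [fset p; q; r]%fset \in T ->
  `|orient p q r| = 1 -> interior D (centroid (e p) (e q) (e r)).
Proof.
move=> tT /norm1_neq0 /orient_embed_neq0 D0; apply: interior_hull3 (tri_subD tT) _ _ _.
all: rewrite /bary /centroid ?(orient_rot (e q)) ?(orient_rot (e p)).
all: set x := (_ / _); have -> : x = 3^-1 by rewrite /x /orient !mxE; move: D0; rewrite /orient !mxE => D0; field.
all: by rewrite invr_gt0.
Qed.

Lemma hull_same_side s (p q r : Z2) z : s = [fset p; q; r]%fset ->
  lattice_hull s z -> 0 <= orient (e p) (e q) (e r) * orient (e p) (e q) z.
Proof.
move=> sE zs; have [D0|D0] := leP 0 (orient (e p) (e q) (e r)).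
  apply: mulr_ge0 => //; apply: hull_orient_ge0 zs => v.
  by rewrite sE in_fset3 => /or3P[] /eqP ->; rewrite ?orient_xyx ?orient_xyy.
rewrite -mulrNN -!orientC mulr_ge0 //; first by rewrite orientC oppr_ge0 ltW.
apply: hull_orient_ge0 zs => v.
rewrite sE in_fset3 => /or3P[] /eqP ->; rewrite ?orient_xyx ?orient_xyy //.
by rewrite orientC oppr_ge0 ltW.
Qed.

Lemma mem_hull_tri s (p q r : Z2) z : s = [fset p; q; r]%fset -> `|orient p q r| = 1 ->
    0 <= orient (e p) (e q) (e r) * orient (e q) (e r) z ->
    0 <= orient (e p) (e q) (e r) * orient (e r) (e p) z ->
    0 <= orient (e p) (e q) (e r) * orient (e p) (e q) z ->
  lattice_hull s z.
Proof.
move=> -> n1 h1 h2 h3; apply: mem_hull3; first exact/orient_embed_neq0/norm1_neq0.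
all: rewrite /bary ?(orient_rot (e q)) ?(orient_rot (e p)).
all: rewrite mulrC; move: h1 h2 h3; rewrite !orient_embed.
all: by case: (norm1_sign n1) => ->; rewrite ?mulrN1z ?invrN ?invr1.
Qed.

(** Hulls of triangles are closed, in the only form that is used: along a line,
    and for one linear inequality. *)
Lemma small_limit_ge0 (x c : R) :
  (forall del, 0 < del -> exists2 eps, 0 < eps < del & 0 <= x + eps * c) -> 0 <= x.
Proof.
move=> h; rewrite leNgt; apply/negP => x0.
have c0 : 0 < 1 + `|c| by rewrite ltr_pwDl.
have [eps /andP[eps0 epsx]] : exists2 eps, 0 < eps < - x / (1 + `|c|) & 0 <= x + eps * c.
  by apply: h; rewrite divr_gt0 // oppr_gt0.
apply/negP; rewrite -ltNge; rewrite ltr_pdivlMr // in epsx.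
have : eps * c <= eps * `|c| by rewrite ler_wpM2l ?ler_norm // ltW.
by lra.
Qed.

(** The middle m of pq is interior too, so points slightly beyond m, seen from the
    third vertex r, still lie in D and are covered by T. *)
Lemma second_triangle s p q : s \in T -> p \in s -> q \in s -> p != q ->
    interior D (e p) ->
  exists t, [/\ t \in T, t != s, p \in t & q \in t].
Proof.
move=> sT ps qs pq pint.
have [r [sE n1]] := tri_edge sT ps qs pq.
have D0 := norm1_neq0 n1; have De := orient_embed_neq0 D0.
pose m : 'rV[R]_2 := 2^-1 *: e p + (1 - 2^-1) *: e q.
have mint : interior D m.
  apply: interior_comb => //; first exact: vertexD sT qs.
  by rewrite invr_gt0 ltr0n invf_le1 // ler1n.
have [del0 del00 zD] := interior_along (m - e r) mint.
pose z (eps : R) := m + eps *: (m - e r).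
pose ok (t : {fset Z2}) (del : R) := exists2 eps, 0 < eps < del & lattice_hull t (z eps).
(* T is finite, so one triangle t contains points z eps with eps arbitrarily
   small, hence their limit m. *)
have [t tT tok] : exists2 t, t \in T & forall del, 0 < del -> ok t del.
  apply: contrapT => none.
  have bad t : t \in T -> exists2 del, 0 < del & ~ ok t del.
    move=> tT; apply: contrapT => h; apply: none; exists t => // del d0.
    by apply: contrapT => nok; apply: h; exists del.
  have [del d0 delP] : exists2 del, 0 < del & forall t, t \in T -> ~ ok t del.
    suff all_bad (ts : seq {fset Z2}) : (forall t, t \in ts -> exists2 del, 0 < del & ~ ok t del) ->
        exists2 del, 0 < del & forall t, t \in ts -> ~ ok t del.
      exact: (all_bad (enum_fset T)).
    elim: ts => [|t ts IH] h; first by exists 1.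
    have [d1 d10 nok1] := h t (mem_head _ _).
    have [d2 d20 nok2] : exists2 del, 0 < del & forall t, t \in ts -> ~ ok t del.
      by apply: IH => u us; apply: h; rewrite inE us orbT.
    exists (Num.min d1 d2) => [|u]; first by rewrite lt_min d10.
    rewrite inE => /predU1P[->|us] [eps /andP[eps0 epsd] zeps].
      by apply: nok1; exists eps => //; rewrite eps0 (lt_le_trans epsd) // ge_min lexx.
    by apply: (nok2 u us); exists eps => //; rewrite eps0 (lt_le_trans epsd) // ge_min lexx orbT.
  pose eps := Num.min del del0 / 2.
  have m0 : 0 < Num.min del del0 by rewrite lt_min d0.
  have eps0 : 0 < eps by rewrite divr_gt0.
  have epsm : eps < Num.min del del0 by rewrite ltr_pdivrMr // mulr_natr mulr2n ltrDl.
  have : D (z eps) by apply: zD; rewrite eps0 (lt_le_trans epsm) // ge_min lexx orbT.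
  case: (triT) => _ <- _ [t /= tT zt]; apply: (delP t tT); exists eps => //.
  by rewrite eps0 (lt_le_trans epsm) // ge_min lexx.
have orient_z a b eps : orient a b (z eps) =
    orient a b m + eps * (orient a b m - orient a b (e r)).
  exact: orient_extrapolate.
have mt : lattice_hull t m.
  have [a [b [c [tE nt]]]] := tri_exists tT.
  have tE' : t = [fset b; c; a]%fset by rewrite fset3_rot.
  have tE'' : t = [fset c; a; b]%fset by rewrite fset3_rot.
  have key x y w : t = [fset x; y; w]%fset ->
      0 <= orient (e x) (e y) (e w) * orient (e x) (e y) m.
    move=> tE0; pose g := orient (e x) (e y) (e w).
    apply: (@small_limit_ge0 _ (g * (orient (e x) (e y) m - orient (e x) (e y) (e r)))).
    move=> del /tok[eps eps_del zt]; exists eps => //.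
    by have := hull_same_side tE0 zt; rewrite orient_z mulrDr mulrCA.
  apply: (mem_hull_tri tE nt); last exact: key.
    by have := key _ _ _ tE'; rewrite (orient_rot (e a)).
  by have := key _ _ _ tE''; rewrite (orient_rot (e b)) (orient_rot (e a)).
have ms : lattice_hull s m.
  have -> : m = 2^-1 *: e p + (1 - 2^-1) *: e q + 0 *: e r by rewrite scale0r addr0.
  by rewrite sE; apply: hull3_comb; lra.
have orient_m a b : orient a b m = 2^-1 * orient a b (e p) + (1 - 2^-1) * orient a b (e q).
  exact: orient_comb2.
exists t; split=> //.
- apply/negP => /eqP ts; rewrite ts in tok.
  have [eps /andP[eps0 _] zs] := tok 1 ltr01.
  have := hull_same_side sE zs; rewrite orient_z orient_m orient_xyx orient_xyy.
  rewrite leNgt => /negP; apply.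
  have : 0 < orient (e p) (e q) (e r) ^+ 2 * eps by rewrite mulr_gt0 // exprn_even_gt0.
  rewrite expr2; lra.
- apply: (shared_vertex sT tT sE ms mt); rewrite orient_m orient_xyx mulr0 addr0.
  by rewrite orient_rot mulf_neq0 // invr_eq0.
have sE' : s = [fset q; r; p]%fset by rewrite fset3_rot.
apply: (shared_vertex sT tT sE' ms mt); rewrite orient_m orient_xyy mulr0 add0r.
by rewrite (orient_rot (e q)) (orient_rot (e p)) mulf_neq0 // subr_eq0 eq_sym invr_eq1 pnatr_eq1.
Qed.

(** * Parity around an interior vertex *)

(** The edge pq belongs to the relative boundary of the union of the triangles
    in X. *)
Definition frontier_edge (X : pred {fset Z2}) (p q : Z2) : Prop :=
  exists s t, [/\ s \in T, t \in T, X s, ~~ X t &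
    [/\ p \in s, q \in s, p \in t & q \in t]].

(** Every edge at the interior point p lies in exactly two triangles, so an edge
    is in the frontier of X when it lies in an odd number of triangles of X. But
    each triangle of X at p has two edges at p, so the number of these edges is
    even. This parity count replaces the cyclic order of the triangles around
    p. *)
Lemma frontier_edge_not_alone (X : pred {fset Z2}) (p q0 : Z2) :
    interior D (e p) -> p != q0 -> frontier_edge X p q0 ->
  exists q1, [/\ q1 != q0, p != q1 & frontier_edge X p q1].
Proof.
move=> pint pq0 [s0 [t0 [s0T t0T Xs0 Xt0 [ps0 qs0 pt0 qt0]]]].
apply: contrapT => alone.
pose S := [seq s <- enum_fset T | X s & p \in s].
pose V := [seq q <- undup (flatten [seq enum_fset s | s <- enum_fset T]) | p != q].
have inV s q : s \in T -> q \in s -> (q \in V) = (p != q).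
  move=> sT qs; rewrite mem_filter mem_undup andb_idr // => _.
  by apply/flattenP; exists (enum_fset s) => //; apply: map_f.
have Suniq : uniq S by apply: filter_uniq; apply: fset_uniq.
have Vuniq : uniq V by rewrite /V; apply: filter_uniq; apply: (@undup_uniq Z2).
have inS s : (s \in S) = [&& X s, p \in s & s \in T] by rewrite mem_filter andbA.
have two_edges s : s \in S -> (\sum_(q <- V) (q \in s) = 2)%N.
  rewrite inS => /and3P[_ ps sT].
  have [a [b [sE /norm1_neq0 /orient_neq0_uniq[pa ab pb]]]] := tri_vertex sT ps.
  rewrite sum_indicator (@perm_size _ _ [:: a; b]) //.
  apply: uniq_perm => [||x]; first exact: filter_uniq.
    by rewrite /= inE ab.
  rewrite mem_filter 2!inE; have [xs|xs] /= := boolP (x \in s).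
    rewrite (inV s x) //; move: xs; rewrite sE in_fset3 => /or3P[] /eqP ->.
    - by rewrite eqxx (negbTE pa) (negbTE pb).
    - by rewrite pa eqxx.
    by rewrite pb eqxx orbT.
  by apply/esym/negbTE; apply: contra xs; rewrite sE in_fset3 => ->; rewrite orbT.
(* Counting the incidences of the triangles of X at p with the edges at p. *)
have total : (\sum_(q <- V) \sum_(s <- S) (q \in s) = 2 * size S)%N.
  rewrite exchange_big /= (eq_big_seq (fun=> 2%N)) //.
  by rewrite big_const_seq count_predT iter_addn_0.
have even_other q : q \in V -> q != q0 -> (2 %| \sum_(s <- S) (q \in s))%N.
  rewrite mem_filter => /andP[pq _] qq0; rewrite sum_indicator.
  have [/hasP[s sS qs]|] := boolP (has (fun s : {fset Z2} => q \in s) S); last first.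
    by rewrite has_filter negbK => /eqP ->.
  move: (sS); rewrite inS => /and3P[Xs ps sT].
  have [t [tT ts pt qt]] := second_triangle sT ps qs pq pint.
  have Xt : X t.
    apply: contraPT isT => Xt _; apply: alone; exists q; split=> //.
    by exists s, t.
  rewrite (@perm_size _ _ [:: s; t]) //; apply: uniq_perm.
  - by rewrite filter_uniq.
  - by rewrite /= inE eq_sym ts.
  move=> u; rewrite mem_filter !inE; apply/andP/orP => [[qu]|[/eqP ->|/eqP ->]].
  - rewrite inS => /and3P[Xu pu uT].
    have := edge_triangles_le2 uT sT tT pq pu qu ps qs pt qt.
    by rewrite [s == t]eq_sym (negbTE ts) orbF => /orP.
  - by [].
  by rewrite inS Xt pt tT.
have one0 : (\sum_(s <- S) (q0 \in s) = 1)%N.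
  rewrite sum_indicator (@perm_size _ _ [:: s0]) //; apply: uniq_perm.
  - by rewrite filter_uniq.
  - by [].
  move=> u; rewrite mem_filter !inE; apply/andP/eqP => [[qu]|->]; last by rewrite inS Xs0 ps0.
  rewrite inS => /and3P[Xu pu uT].
  have /or3P[/eqP //|/eqP E|/eqP E] := edge_triangles_le2 uT s0T t0T pq0 pu qu ps0 qs0 pt0 qt0.
    by rewrite E (negbTE Xt0) in Xu.
  by rewrite E (negbTE Xt0) in Xs0.
have q0V : q0 \in V by rewrite (inV s0).
have : (2 %| \sum_(q <- V) \sum_(s <- S) (q \in s))%N by rewrite total dvdn_mulr.
rewrite (bigD1_seq q0) //= one0 dvdn_addl // big_seq_cond.
by apply: dvdn_sum => q /andP[]; apply: even_other.
Qed.

(** * Splitting edges *)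

Lemma share_edgeP s t : share_edge s t ->
  s != t /\ exists p q : Z2, [/\ p != q, p \in s, q \in s, p \in t & q \in t].
Proof.
case/andP => st /eqP card2; split=> //.
have uniq_st := fset_uniq (s `&` t)%fset.
have in_st x : x \in enum_fset (s `&` t)%fset -> x \in s /\ x \in t.
  by move=> xst; apply/andP; rewrite -in_fsetI.
move: (enum_fset _) uniq_st in_st card2 => [|p [|q [|]]] //= /andP[pq _] in_st _.
have [ps pt] := in_st p (mem_head _ _).
have [qs qt] : q \in s /\ q \in t by apply: in_st; rewrite !inE eqxx orbT.
by exists p, q; split=> //; rewrite inE in pq.
Qed.

Lemma share_edge_intro s t p q : s \in T -> t \in T -> s != t -> p != q ->
  p \in s -> q \in s -> p \in t -> q \in t -> share_edge s t.
Proof.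
move=> sT tT st pq ps qs pt qt; rewrite /share_edge st /=.
have [r [sE /norm1_neq0 /orient_neq0_uniq[_ qr pr]]] := tri_edge sT ps qs pq.
have [r' [tE _]] := tri_edge tT pt qt pq.
suff -> : (s `&` t)%fset = [fset p; q]%fset by rewrite cardfs2 pq.
apply/fsetP => x; rewrite inE sE tE !in_fset3 !inE.
have [->|xp] //= := eqVneq x p; have [->|xq] //= := eqVneq x q.
apply/negbTE/negP => /andP[/eqP -> /eqP rr'].
by move: st; rewrite sE tE rr' eqxx.
Qed.

Lemma orient_centroid (p q a b c : 'rV[R]_2) :
  orient p q (centroid a b c) = 3^-1 * (orient p q a + orient p q b + orient p q c).
Proof. by rewrite /centroid /orient !mxE; field. Qed.

Lemma centroid_in_D (a b c : Z2) : [fset a; b; c]%fset \in T ->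
  D (centroid (e a) (e b) (e c)).
Proof.
move=> /tri_subD; apply.
have -> : centroid (e a) (e b) (e c) = 3^-1 *: e a + 3^-1 *: e b + 3^-1 *: e c.
  by rewrite /centroid !scalerDr.
by apply: hull3_comb; lra.
Qed.

(** An edge pq, common to the triangles s and t, which cuts D into two pieces. *)
Definition split_edge s t (p q : Z2) : Prop :=
  [/\ s \in T, t \in T, s != t, p != q &
    [/\ p \in s, q \in s, p \in t & q \in t]] /\
  ~ interior D (e p) /\ ~ interior D (e q).

(** The triangle u lies in the closed half-plane of r with respect to pq. *)
Definition on_side (p q r : Z2) (u : {fset Z2}) : bool :=
  all (fun z => 0 <= orient p q r * orient p q z) (enum_fset u).

Lemma split_edge_flip s t p q : split_edge s t p q -> split_edge s t q p.
Proof.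
move=> [[sT tT st pq [ps qs pt qt]] [pb qb]].
by split; [split; rewrite // eq_sym | split].
Qed.

Lemma split_line_half s t (p q r : Z2) z : split_edge s t p q ->
    s = [fset p; q; r]%fset -> `|orient p q r| = 1 ->
    D z -> orient (e p) (e q) z = 0 ->
  0 <= bary (e p) (e q) (e r) z.
Proof.
move=> [[sT tT st pq [ps qs pt qt]] [_ qb]] sE n1 zD z0.
have [r' [tE n1']] := tri_edge tT pt qt pq.
have D0 := norm1_neq0 n1; have De := orient_embed_neq0 D0.
have opp := edge_opposite_sides sT tT st sE tE n1 n1'.
rewrite leNgt; apply/negP => neg; apply: qb.
apply: (@interior_beyond_edge _ D (e p) (e q) (e r) (e r') z) => //.
- by apply: interior_centroid; rewrite -?sE.
- exact: vertexD sT ps.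
- by apply: (vertexD tT); rewrite tE in_fset3 eqxx !orbT.
- rewrite /bary !(orient_rot (e q)) (orient_rot (e p)) !orient_embed opp.
  by rewrite rmorphN /= mulNr mulfV ?intr_eq0 // ltrN10.
by rewrite /bary z0 mul0r.
Qed.

(** A splitting edge is all of the intersection of D with its line: beyond its
    ends that line has left D. *)
Lemma split_line s t (p q : Z2) z : split_edge s t p q ->
  D z -> orient (e p) (e q) z = 0 -> lattice_hull s z.
Proof.
move=> spl zD z0; case: (spl) => -[sT _ _ pq [ps qs _ _]] _.
have [r [sE n1]] := tri_edge sT ps qs pq.
rewrite sE; apply: mem_hull3; first exact/orient_embed_neq0/norm1_neq0.
- exact: split_line_half spl sE n1 zD z0.
- rewrite -bary_flip; apply: (split_line_half (split_edge_flip spl)) zD _.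
  + by rewrite fset3_swap12.
  + by rewrite orientC normrN.
  by rewrite orientC z0 oppr0.
by rewrite /bary z0 mul0r.
Qed.

Lemma split_line_vertex s t (p q : Z2) u x : split_edge s t p q ->
  u \in T -> x \in u -> orient p q x = 0 -> x = p \/ x = q.
Proof.
move=> spl uT xu x0; case: (spl) => -[sT _ _ pq [ps qs _ _]] _.
have [r [sE n1]] := tri_edge sT ps qs pq.
have : x \in s.
  apply: (vertex_in_hull uT sT xu); apply: (split_line spl (vertexD uT xu)).
  by rewrite orient_embed x0.
rewrite sE in_fset3 => /or3P[] /eqP xE; [by left | by right |].
by move/norm1_neq0: n1; rewrite -xE x0 eqxx.
Qed.

(** A triangle meeting both sides of the line pq would cross it at a point of D,
    hence of the edge pq, and so in the interior of one of its own edges; but two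
    triangles meet in a common face. *)
Lemma split_no_crossing s t (p q : Z2) u x y : split_edge s t p q ->
  u \in T -> x \in u -> y \in u -> 0 < orient p q x -> orient p q y < 0 -> False.
Proof.
move=> spl uT xu yu x0 y0; case: (spl) => -[sT _ _ pq [ps qs _ _]] _.
have [r [sE n1]] := tri_edge sT ps qs pq.
have xy : x != y by apply: contraTneq x0 => ->; rewrite -leNgt ltW.
have [w [uE /norm1_neq0 /orient_embed_neq0 De]] := tri_edge uT xu yu xy.
pose g1 : R := orient (e p) (e q) (e x); pose g2 : R := orient (e p) (e q) (e y).
have g10 : 0 < g1 by rewrite /g1 orient_embed ltr0z.
have g20 : g2 < 0 by rewrite /g2 orient_embed ltrz0.
have g12 : 0 < g1 - g2 by lra.
pose c := - g2 / (g1 - g2).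
have c0 : 0 < c by rewrite divr_gt0 // oppr_gt0.
have c1 : c < 1 by rewrite ltr_pdivrMr // mul1r; lra.
pose z : 'rV[R]_2 := c *: e x + (1 - c) *: e y.
have zu : lattice_hull u z.
  have -> : z = c *: e x + (1 - c) *: e y + 0 *: e w by rewrite scale0r addr0.
  by rewrite uE; apply: hull3_comb; lra.
have z0 : orient (e p) (e q) z = 0.
  by rewrite orient_comb2 -/g1 -/g2 /c; field; rewrite gt_eqF.
have zs := split_line spl (tri_subD uT zu) z0.
have onr v : v \in s -> orient p q v != 0 -> v = r.
  rewrite sE in_fset3 => /or3P[] /eqP -> //; first by rewrite orient_xyx.
  by rewrite orient_xyy.
have xs : x \in s.
  apply: (shared_vertex uT sT uE zu zs).
  by rewrite orient_comb2 orient_xyx mulr0 addr0 orient_rot mulf_neq0 // gt_eqF.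
have ys : y \in s.
  have uE' : u = [fset y; w; x]%fset by rewrite fset3_rot.
  apply: (shared_vertex uT sT uE' zu zs).
  rewrite orient_comb2 orient_xyy mulr0 add0r (orient_rot (e y)) (orient_rot (e x)).
  by rewrite mulf_neq0 // subr_eq0 gt_eqF.
have xr := onr x xs (lt0r_neq0 x0); have yr := onr y ys (ltr0_neq0 y0).
by rewrite xr yr eqxx in xy.
Qed.

Lemma off_side_le0 s t (p q r : Z2) u : split_edge s t p q -> `|orient p q r| = 1 ->
    u \in T -> ~~ on_side p q r u ->
  forall z, z \in u -> orient p q r * orient p q z <= 0.
Proof.
move=> spl n1 uT /allPn[y yu]; rewrite -ltNge => y0 z zu.
rewrite leNgt; apply/negP => z0.
case: (norm1_sign n1) => E; rewrite E ?mul1r ?mulN1r ?oppr_gt0 ?oppr_lt0 in y0 z0.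
  exact: split_no_crossing spl uT zu yu z0 y0.
exact: split_no_crossing spl uT yu zu y0 z0.
Qed.

Lemma on_side_self s t (p q r : Z2) : split_edge s t p q ->
  s = [fset p; q; r]%fset -> on_side p q r s.
Proof.
move=> _ ->; apply/allP => z; rewrite in_fset3 => /or3P[] /eqP ->.
- by rewrite orient_xyx mulr0.
- by rewrite orient_xyy mulr0.
by rewrite -expr2 sqr_ge0.
Qed.

Lemma on_side_twin s t (p q r : Z2) : split_edge s t p q ->
  s = [fset p; q; r]%fset -> `|orient p q r| = 1 -> ~~ on_side p q r t.
Proof.
move=> [[sT tT st pq [ps qs pt qt]] _] sE n1.
have [r' [tE n1']] := tri_edge tT pt qt pq.
have opp := edge_opposite_sides sT tT st sE tE n1 n1'.
apply/allPn; exists r'; first by rewrite tE in_fset3 eqxx !orbT.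
by rewrite opp mulrN oppr_ge0 -ltNge -expr2 exprn_even_gt0 // norm1_neq0.
Qed.

(** The common edge of triangles on different sides lies on the line pq, so it is
    the edge pq itself, which belongs to s and t only. *)
Lemma on_side_adjacent s t (p q r : Z2) u u' : split_edge s t p q ->
    s = [fset p; q; r]%fset -> `|orient p q r| = 1 ->
    u \in T -> u' \in T -> share_edge u u' ->
    on_side p q r u -> ~~ on_side p q r u' ->
  u = s /\ u' = t.
Proof.
move=> spl sE n1 uT u'T /share_edgeP[uu' [x [y [xy xu yu xu' yu']]]] su su'.
case: (spl) => -[sT tT st pq [ps qs pt qt]] _.
have on_line v : v \in u -> v \in u' -> v = p \/ v = q.
  move=> vu vu'; apply: (split_line_vertex spl uT vu).
  have ge0 := allP su v vu; have le0 := off_side_le0 spl n1 u'T su' vu'.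
  have : orient p q r * orient p q v = 0 by apply/le_anti/andP.
  by move/eqP; rewrite mulf_eq0 (negbTE (norm1_neq0 n1)) => /eqP.
have [pu qu pu' qu'] : [/\ p \in u, q \in u, p \in u' & q \in u'].
  by case: (on_line x xu xu') => xE; case: (on_line y yu yu') => yE;
    move: xy xu xu' yu yu'; rewrite xE yE ?eqxx.
split.
  have /or3P[/eqP //|/eqP E|] := edge_triangles_le2 uT sT tT pq pu qu ps qs pt qt.
    by have := on_side_twin spl sE n1; rewrite -E su.
  by rewrite (negbTE st).
have /or3P[/eqP E|/eqP //|] := edge_triangles_le2 u'T sT tT pq pu' qu' ps qs pt qt.
  by have := on_side_self spl sE; rewrite -E (negbTE su').
by rewrite (negbTE st).
Qed.

(** * Cores of the dual graph *)

Lemma split_triangle_off_line s t (p q : Z2) u : split_edge s t p q -> u \in T ->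
  exists2 z, z \in u & orient p q z != 0.
Proof.
move=> spl uT; have [a [b [c [uE /norm1_neq0 /orient_neq0_uniq[ab bc ac]]]]] := tri_exists uT.
have [au bu cu] : [/\ a \in u, b \in u & c \in u] by rewrite uE !in_fset3 !eqxx !orbT.
have [a0|] := eqVneq (orient p q a) 0; last by exists a.
have [b0|] := eqVneq (orient p q b) 0; last by exists b.
have [c0|] := eqVneq (orient p q c) 0; last by exists c.
have := split_line_vertex spl uT au a0; have := split_line_vertex spl uT bu b0.
have := split_line_vertex spl uT cu c0.
by case=> cE [] bE [] aE; move: ab bc ac; rewrite aE bE cE eqxx.
Qed.

Lemma centroid_off_side (p q r a b c z : Z2) : `|orient p q r| = 1 ->
    (forall v, v \in [fset a; b; c]%fset -> orient p q r * orient p q v <= 0) ->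
    z \in [fset a; b; c]%fset -> orient p q z != 0 ->
  bary (e r) (e p) (e q) (centroid (e a) (e b) (e c)) < 0.
Proof.
move=> n1 le0 zv z0; rewrite /bary orient_centroid !orient_embed.
rewrite (orient_rot q) (orient_rot p).
have [la lb lc] : [/\ orient p q r * orient p q a <= 0,
    orient p q r * orient p q b <= 0 & orient p q r * orient p q c <= 0].
  by split; apply: le0; rewrite in_fset3 eqxx ?orbT.
have lt0 : orient p q r * (orient p q a + orient p q b + orient p q c) < 0.
  move: zv z0 la lb lc; rewrite in_fset3.
  by case: (norm1_sign n1) => -> /or3P[] /eqP ->; lia.
have -> : 3^-1 * ((orient p q a)%:~R + (orient p q b)%:~R + (orient p q c)%:~R) / (orient p q r)%:~R
  = 3^-1 * (orient p q r * (orient p q a + orient p q b + orient p q c))%:~R :> R.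
  by case: (norm1_sign n1) => ->; rewrite ?mul1r ?mulN1r ?rmorphN /= !rmorphD /=; field.
by rewrite pmulr_rlt0 ?invr_gt0 // ltrz0.
Qed.

(** The relation A is the adjacency in a core of the dual graph. If all the edges
    crossed by A were splitting edges, A could be followed without ever turning
    back: after crossing pq into t, it leaves t by another edge, and the piece of
    D beyond that edge is contained in the piece beyond pq, without t. So the
    number of triangles ahead would decrease forever. *)
Lemma core_interior_vertex (A : {fset Z2} -> {fset Z2} -> Prop) :
    (exists s t, A s t) -> (forall s t, A s t -> A t s) ->
    (forall s t, A s t -> [/\ s \in T, t \in T & share_edge s t]) ->
    (forall s t, A s t -> exists2 u, A s u & u != t) ->
  exists s t p, [/\ A s t, p \in s, p \in t & interior D (e p)].
Proof.
move=> [s0 [t0 A0]] Asym AT Acomp; apply: contrapT => noint.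
have bdry s t p : A s t -> p \in s -> p \in t -> ~ interior D (e p).
  by move=> Ast ps pt pint; apply: noint; exists s, t, p.
(* The number of triangles beyond the edge pq, the opposite side to r. *)
pose beyond p q r := count (fun x => ~~ on_side p q r x) (enum_fset T).
suff no_min n : forall s t p q r, A s t -> s = [fset p; q; r]%fset ->
    `|orient p q r| = 1 -> p \in t -> q \in t -> (beyond p q r < n)%N -> False.
  have [s0T t0T /share_edgeP[_ [p [q [pq ps qs pt qt]]]]] := AT _ _ A0.
  have [r [sE n1]] := tri_edge s0T ps qs pq.
  exact: (no_min _ _ _ _ _ _ A0 sE n1 pt qt (ltnSn _)).
elim: n => // n IHn s t p q r Ast sE n1 pt qt lt_n.
have [sT tT /share_edgeP[st _]] := AT _ _ Ast.
have [pq _ _] := orient_neq0_uniq (norm1_neq0 n1).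
have ps : p \in s by rewrite sE in_fset3 eqxx.
have qs : q \in s by rewrite sE in_fset3 eqxx orbT.
have pb := bdry _ _ _ Ast ps pt; have qb := bdry _ _ _ Ast qs qt.
have spl : split_edge s t p q by split.
have [r' [tE n1']] := tri_edge tT pt qt pq.
have opp := edge_opposite_sides sT tT st sE tE n1 n1'.
have [u Atu us] := Acomp _ _ (Asym _ _ Ast).
have [_ uT /share_edgeP[tu [x [y [xy xt yt xu yu]]]]] := AT _ _ Atu.
have r't : r' \in t by rewrite tE in_fset3 eqxx !orbT.
have not_pq : ~ (p \in u /\ q \in u).
  move=> [pu qu]; have := edge_triangles_le2 sT tT uT pq ps qs pt qt pu qu.
  by rewrite (negbTE st) (negbTE tu) eq_sym (negbTE us).
have [r'u pqu] : r' \in u /\ (p \in u \/ q \in u).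
  move: xt yt; rewrite tE !in_fset3 => /or3P[] /eqP xE /or3P[] /eqP yE;
  rewrite xE in xu xy; rewrite yE in yu xy; rewrite ?eqxx // in xy;
  solve [by split; auto | by case: not_pq].
wlog qu : p q sE n1 pt qt lt_n pq ps qs pb qb spl tE n1' opp not_pq pqu / q \in u.
  move=> wl; case: pqu => [pu|qu]; last by apply: (wl p q) => //; right.
  apply: (wl q p) => //.
  - by rewrite fset3_swap12.
  - by rewrite orientC normrN.
  - rewrite (leq_ltn_trans _ lt_n) // /beyond (eq_count (a2 := fun x => ~~ on_side p q r x)) //.
    by move=> v; congr (~~ _); apply: eq_all => z; rewrite /= (orientC p q r) (orientC p q z) mulrNN.
  - by rewrite eq_sym.
  - exact: split_edge_flip.
  - by rewrite fset3_swap12.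
  - by rewrite orientC normrN.
  - by rewrite !(orientC p q) opp.
  - by case=> hq hp; apply: not_pq.
  by right.
have tE' : t = [fset q; r'; p]%fset by rewrite fset3_rot.
have n1'' : `|orient q r' p| = 1 by rewrite orient_rot.
have [_ qr' pr'] := orient_neq0_uniq (norm1_neq0 n1').
have spl' : split_edge t u q r'.
  by split; [split | split; [exact: bdry Atu qt qu | exact: bdry Atu r't r'u]].
apply: (IHn t u q r' p Atu tE' n1'' qu r'u).
rewrite -ltnS (leq_trans _ lt_n) // ltnS /beyond -!size_filter.
(* A triangle beyond q r' and not beyond p q would meet the angle opposite to
   the corner of t at q, which makes q an interior point. *)
have sub_beyond v : v \in T -> ~~ on_side q r' p v -> ~~ on_side p q r v.
  move=> vT off'; apply/negP => on.
  have le1 := off_side_le0 spl' n1'' vT off'.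
  have le2 z : z \in v -> orient p q r' * orient p q z <= 0.
    by move=> zv; rewrite opp mulNr oppr_le0; apply: (allP on).
  have [z1 z1v z10] := split_triangle_off_line spl' vT.
  have [z2 z2v z20] := split_triangle_off_line spl vT.
  have [a [b [c [vE _]]]] := tri_exists vT.
  apply: qb; apply: (@interior_opposite_wedge _ D (e p) (e q) (e r') (centroid (e a) (e b) (e c))) => //.
  - by apply: interior_centroid; rewrite -?tE.
  - exact: vertexD sT ps.
  - exact: vertexD tT r't.
  - by apply: centroid_in_D; rewrite -vE.
  - exact/orient_embed_neq0/norm1_neq0.
  - apply: (@centroid_off_side q r' p a b c z1) => //; rewrite -vE //.
  by apply: (@centroid_off_side p q r' a b c z2) => //; rewrite -vE.
apply: (@uniq_leq_size _ (t :: _)) => [|v].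
  rewrite /= filter_uniq ?fset_uniq // andbT mem_filter negb_and negbK.
  by rewrite (on_side_self spl' tE').
rewrite inE !mem_filter => /predU1P[->|/andP[off vT]].
  by rewrite (on_side_twin spl sE n1).
by rewrite sub_beyond.
Qed.

(** * Vertical angles *)

(** The barycentric coordinate [bary], as an integer: in a unimodular triangle
    the division by the determinant 1 or -1 is a multiplication by it. *)
Definition weight (a b c z : Z2) : int := orient a b c * orient b c z.

Lemma weight_swap a b c z : weight a c b z = weight a b c z.
Proof. by rewrite /weight /orient; ring. Qed.

Lemma weight_sum a b c z : `|orient a b c| = 1 ->
  weight a b c z + weight b c a z + weight c a b z = 1.
Proof.
move=> n1; rewrite /weight (orient_rot b) !(orient_rot a) -!mulrDr orient_sum.
by case: (norm1_sign n1) => ->.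
Qed.

Lemma bary_weight a b c z : `|orient a b c| = 1 ->
  bary (e a) (e b) (e c) (e z) = (weight a b c z)%:~R.
Proof.
move=> n1; rewrite /bary /weight !orient_embed rmorphM /=.
by case: (norm1_sign n1) => ->; rewrite ?rmorphN /= mulrC ?invrN invr1.
Qed.

Lemma weight_comb p q r a b c z : `|orient a b c| = 1 ->
  weight p q r z = weight a b c z * weight p q r a + weight b c a z * weight p q r b
    + weight c a b z * weight p q r c.
Proof.
move=> n1.
have sq : orient a b c * orient a b c = 1 by case: (norm1_sign n1) => ->.
rewrite -[LHS]mul1r -sq /weight (orient_rot b) !(orient_rot a).
by rewrite /orient; ring.
Qed.

Lemma weight_decomp a b c z : `|orient a b c| = 1 ->
  z = weight a b c z *: a + weight b c a z *: b + weight c a b z *: c.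
Proof.
move=> n1.
have sq : orient a b c * orient a b c = 1 by case: (norm1_sign n1) => ->.
rewrite -[LHS]scale1r -sq /weight (orient_rot b) !(orient_rot a).
apply/rowP => i; rewrite !mxE; case: i => [[|[|//]] ilt].
  have -> : Ordinal ilt = 0 by apply: val_inj.
  by rewrite /orient; ring.
have -> : Ordinal ilt = 1 by apply: val_inj.
by rewrite /orient; ring.
Qed.

Lemma orient_perm_norm1 (a b c : Z2) : `|orient a b c| = 1 ->
  [/\ `|orient b c a| = 1, `|orient a c b| = 1 & `|orient b a c| = 1].
Proof.
have E : orient a c b = - orient a b c by rewrite /orient; ring.
move=> n1; split.
- by rewrite orient_rot.
- by rewrite E normrN.
by rewrite orientC normrN.
Qed.

(** Coordinates with origin c and basis a, b. An interior point beyond the line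
    ab cannot lie on or below the first axis, for it would make a interior. *)
Lemma far_point_above a b c y : `|orient a b c| = 1 ->
    D (e b) -> D (e c) -> ~ interior D (e a) -> interior D (e y) ->
    weight c a b y < 0 ->
  0 < weight b c a y.
Proof.
move=> n1 bD cD ab yint wc; rewrite ltNge; apply/negP => wb; apply: ab.
have [n1b n1' n1b'] := orient_perm_norm1 n1; have sum1 := weight_sum y n1.
apply: (@interior_below_ray _ D (e a) (e b) (e c) (e y)) => //.
- exact/orient_embed_neq0/norm1_neq0.
- rewrite (bary_weight _ n1') (bary_weight _ n1b') (weight_swap a) (weight_swap b).
  by rewrite -rmorphD /= ltr1z; lia.
by rewrite (bary_weight _ n1b') weight_swap lerz0.
Qed.

Lemma opposite_signs_interior a b c y z : `|orient a b c| = 1 ->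
    D (e c) -> interior D (e y) -> D (e z) ->
    0 < weight a b c y -> 0 < weight b c a y ->
    0 < weight a b c z -> weight b c a z < 0 ->
  interior D (e a).
Proof.
move=> n1 cD yint zD ya yb za zb; have [n1b n1' n1b'] := orient_perm_norm1 n1.
apply: (@interior_across_ray _ D (e a) (e b) (e c) (e y) (e z)) => //.
- exact/orient_embed_neq0/norm1_neq0.
- by rewrite (bary_weight _ n1') weight_swap ler1z.
- by rewrite (bary_weight _ n1b') weight_swap ltr0z.
- by rewrite (bary_weight _ n1') weight_swap ler1z.
by rewrite (bary_weight _ n1b') weight_swap ltrz0.
Qed.

(** Coordinates with origin c and basis a, b; those of y are positive. If those of
    z had opposite signs, the first one being positive, say, then the segment from
    y to z would cross the ray from c through a in a point which is not before a,
    since a positive integer is at least 1. As y is interior, so would be a. *)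
Lemma vertical_angles a b c y z : `|orient a b c| = 1 ->
    D (e a) -> D (e b) -> D (e c) -> ~ interior D (e a) -> ~ interior D (e b) ->
    interior D (e y) -> weight c a b y < 0 -> D (e z) ->
  (0 <= weight a b c z /\ 0 <= weight b c a z) \/
  (weight a b c z <= 0 /\ weight b c a z <= 0).
Proof.
move=> n1 aD bD cD aN bN yint yc zD; have [n1b n1' n1b'] := orient_perm_norm1 n1.
have yb := far_point_above n1 bD cD aN yint yc.
have ya : 0 < weight a b c y.
  rewrite -weight_swap; apply: far_point_above n1b' aD cD bN yint _.
  by rewrite weight_swap.
have nab : ~ (0 < weight a b c z /\ weight b c a z < 0).
  move=> [za zb]; apply: aN; exact: opposite_signs_interior n1 cD yint zD ya yb za zb.
have nba : ~ (0 < weight b c a z /\ weight a b c z < 0).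
  move=> [zb za]; apply: bN.
  by apply: (opposite_signs_interior n1b' cD yint zD); rewrite weight_swap.
lia.
Qed.

End Triangulation.

(** * Labelled triangulations *)

(** [tie_labelling] for the dual graph of T, with triangles and adjacency in
    place of vertices and darts. *)
Record dual_labelling (T : {fset {fset Z2}}) (lab : {fset Z2} -> part) : Prop :=
  DualLabelling {
  dual_hub_inj : forall s t, s \in T -> t \in T ->
    is_hub (lab s) -> lab s = lab t -> s = t;
  dual_hub_target : forall s t i, s \in T -> t \in T -> share_edge s t ->
    lab s = hub i -> hub_neighbour i (lab t);
  dual_hub_edge_inj : forall s t t', s \in T -> t \in T -> t' \in T ->
    share_edge s t -> share_edge s t' -> is_hub (lab s) -> lab t = lab t' -> t = t';
  dual_hub_edge_exists : forall i X, hub_neighbour i X ->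
    exists s t, [/\ s \in T, t \in T, share_edge s t, lab s = hub i & lab t = X];
  dual_part_separated : forall s t, s \in T -> t \in T -> share_edge s t ->
    ~~ is_hub (lab s) -> ~~ is_hub (lab t) -> lab t = lab s;
  dual_part_connected : forall X (sigma : {fset Z2} -> bool), ~~ is_hub X ->
    (forall s t, s \in T -> t \in T -> share_edge s t -> lab s = X -> lab t = X ->
       sigma t = sigma s) ->
    forall s t, s \in T -> t \in T -> lab s = X -> lab t = X -> sigma s = sigma t;
  dual_part_core : forall X, ~~ is_hub X ->
    exists A : {fset Z2} -> {fset Z2} -> Prop,
      [/\ exists s t, A s t, forall s t, A s t -> A t s,
          forall s t, A s t -> [/\ s \in T, t \in T & share_edge s t],
          forall s t, A s t -> exists2 u, A s u & u != t &
          forall s t, A s t -> lab s = X] }.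

Lemma dual_dart_inj (T : {fset {fset Z2}}) (d d' : dart (dual_graph T)) :
  base d = base d' -> base (flip d) = base (flip d') -> d = d'.
Proof.
case: d d' => -[a b] ab [[a' b'] ab'] /= aa' bb'; apply: val_inj => /=.
by move: aa' bb'; rewrite /dual_base /= => -> ->.
Qed.

Lemma dual_dart_share (T : {fset {fset Z2}}) (d : dart (dual_graph T)) :
  share_edge (val (base d : T)) (val (base (flip d) : T)).
Proof. exact: (svalP d). Qed.

Lemma dual_labelling_of_graph (T : {fset {fset Z2}}) (lab : vertex (dual_graph T) -> part) :
  tie_labelling lab -> exists lab', dual_labelling T lab'.
Proof.
case=> linj ltarget ldinj lex lsep lcon lcore.
(* Sets which are not triangles of T get a dummy label. *)
pose L (s : {fset Z2}) : part := if insub s is Some x then lab x else hub ord0.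
have dart_share := @dual_dart_share T.
have LE (x : T) : L (val x) = lab x by rewrite /L valK.
have LT s (sT : s \in T) : L s = lab [` sT]%fset by rewrite -LE.
have dart_of s t (sT : s \in T) (tT : t \in T) : share_edge s t ->
    exists d : dart (dual_graph T), base d = [` sT]%fset /\ base (flip d) = [` tT]%fset.
  move=> st.
  by exists (exist (fun st : T * T => share_edge (val st.1) (val st.2))
    ([` sT]%fset, [` tT]%fset) st).
exists L; split.
- move=> s t sT tT; rewrite !LT => h E.
  by have /(congr1 val) := linj _ _ h E.
- move=> s t i sT tT st; rewrite !LT; have [d [<- <-]] := dart_of _ _ sT tT st.
  exact: ltarget.
- move=> s t t' sT tT t'T st st'; rewrite !LT.
  have [d [ds dt]] := dart_of _ _ sT tT st; have [d' [ds' dt']] := dart_of _ _ sT t'T st'.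
  rewrite -ds -dt -dt' => h E.
  have dd' : d = d'.
    by apply: ldinj; rewrite ?ds' ?ds // -ds.
  by move: dt'; rewrite -dd' dt => /(congr1 val).
- move=> i X /lex[d [<- <-]]; exists (val (base d : T)), (val (base (flip d) : T)).
  by rewrite !LE; split=> //; apply: valP.
- move=> s t sT tT st; rewrite !LT; have [d [<- <-]] := dart_of _ _ sT tT st.
  exact: lsep.
- move=> X sigma nX sigE s t sT tT; rewrite !LT => sX tX.
  apply: (lcon X (fun x : T => sigma (val x)) nX _ [` sT]%fset [` tT]%fset sX tX) => d dX fdX.
  by apply: sigE; rewrite ?LE //; apply: valP.
move=> X /lcore[A [[/set0Pn[d0 d0A] Aflip Acomp] AX]].
exists (fun s t => exists2 d, d \in A & s = val (base d : T) /\ t = val (base (flip d) : T)).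
split.
- by exists (val (base d0 : T)), (val (base (flip d0) : T)), d0.
- move=> s t [d dA [-> ->]]; exists (flip d); first exact: Aflip.
  by rewrite flipK.
- by move=> s t [d dA [-> ->]]; split; rewrite ?dual_dart_share //; apply: valP.
- move=> s t [d dA [-> ->]]; have [d' [d'A bd' d'd]] := Acomp d dA.
  exists (val (base (flip d') : T)); first by exists d'; rewrite ?bd'.
  apply: contra d'd => /eqP/val_inj fE; apply/eqP.
  exact: dual_dart_inj.
by move=> s t [d dA [-> _]]; rewrite LE AX.
Qed.

Section Degree.
Variable R : realType.
Variables (D : set 'rV[R]_2) (T : {fset {fset Z2}}).
Hypothesis convexD : segment_closed D.
Hypothesis triT : unimodular_triangulation D T.

Lemma shared_vertex_on_edge s t p q x : s \in T -> t \in T -> s != t -> p != q ->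
    p \in s -> q \in s -> p \in t -> q \in t -> x \in s -> x \in t ->
  x = p \/ x = q.
Proof.
move=> sT tT st pq ps qs pt qt.
have [r [sE _]] := tri_edge triT sT ps qs pq.
have [r' [tE _]] := tri_edge triT tT pt qt pq.
rewrite sE tE !in_fset3 => /or3P[] /eqP -> ; [by left | by right |].
move=> /or3P[] /eqP rE; [by left | by right |].
by move: st; rewrite sE tE rE eqxx.
Qed.

Lemma dual_degree_le3 (x : vertex (dual_graph T)) : (degree x <= 3)%N.
Proof.
have xT := valP (x : T); set t := val (x : T) in xT.
have [a [b [c [tE /norm1_neq0 /orient_neq0_uniq[ab bc ac]]]]] := tri_exists triT xT.
(* A dart is determined by the vertex of the triangle which it leaves out. *)
pose left_out (d : dart (dual_graph T)) : 'I_3 :=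
  let s := val (base (flip d) : T) in
  if a \notin s then inord 0 else if b \notin s then inord 1 else inord 2.
pose sides := [:: (b, c); (a, c); (a, b)].
have left_outP d : base d = x ->
    let pq := nth (b, c) sides (left_out d) in let s := val (base (flip d) : T) in
    [/\ pq.1 != pq.2, pq.1 \in t, pq.2 \in t, pq.1 \in s & pq.2 \in s].
  move=> dx /=; have := dual_dart_share d; rewrite dx -/t /left_out.
  set s := val _ => /share_edgeP[_ [p [q [pq pt qt ps qs]]]].
  have inE3 v : v \in t -> [\/ v = a, v = b | v = c].
    by rewrite tE in_fset3 => /or3P[] /eqP; [constructor 1 | constructor 2 | constructor 3].
  have [at' bt ct] : [/\ a \in t, b \in t & c \in t] by rewrite tE !in_fset3 !eqxx !orbT.
  have [as'|as'] /= := boolP (a \in s); first have [bs|bs] /= := boolP (b \in s).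
  - by rewrite inordK //=.
  - rewrite inordK //=; split=> //.
    by move: pq ps qs; case: (inE3 p pt) => ->; case: (inE3 q qt) => ->;
      rewrite ?eqxx ?(negbTE bs).
  rewrite inordK //=; split=> //.
    by move: pq ps qs; case: (inE3 p pt) => ->; case: (inE3 q qt) => ->;
      rewrite ?eqxx ?(negbTE as').
  by move: pq ps qs; case: (inE3 p pt) => ->; case: (inE3 q qt) => ->;
    rewrite ?eqxx ?(negbTE as').
rewrite /degree -[leqRHS]card_ord -(card_in_imset (f := left_out)) ?max_card //.
move=> d d'; rewrite !inE => /eqP dx /eqP d'x E.
apply: dual_dart_inj; first by rewrite dx d'x.
apply: val_inj; have := left_outP d dx; have := left_outP d' d'x; rewrite E /=.
move=> [_ _ _ p' q'] [pq pt qt p1 q1].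
have := edge_triangles_le2 triT (valP (base (flip d) : T)) (valP (base (flip d') : T)) xT
  pq p1 q1 p' q' pt qt.
have /share_edgeP[n1 _] := dual_dart_share d; have /share_edgeP[n2 _] := dual_dart_share d'.
move: n1 n2; rewrite dx d'x -/t => n1 n2.
by rewrite ![_ == t]eq_sym (negbTE n1) (negbTE n2) !orbF => /eqP.
Qed.

End Degree.

(** * The two hubs *)

Section NoTieFighter.
Variable R : realType.
Variables (D : set 'rV[R]_2) (T : {fset {fset Z2}}) (lab : {fset Z2} -> part).
Hypothesis convexD : segment_closed D.
Hypothesis triT : unimodular_triangulation D T.
Hypothesis labT : dual_labelling T lab.
Local Notation e := (embed R).
Local Notation pod0 := (pod ord0).
Local Notation pod1 := (pod ord_max).

(** The apex c is the vertex of t which is not on the edge dual to the bridge. *)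
Record hub_star (i : 'I_2) (t : {fset Z2}) (a b c : Z2) (w n0 n1 : {fset Z2}) : Prop :=
  HubStar {
  star_in : [/\ t \in T, w \in T, n0 \in T & n1 \in T];
  star_lab : [/\ lab t = hub i, lab w = wing i, lab n0 = pod0 & lab n1 = pod1];
  star_share : [/\ share_edge t w, share_edge t n0 & share_edge t n1];
  star_tri : t = [fset a; b; c]%fset;
  star_norm : `|orient a b c| = 1;
  star_wing : a \in w /\ b \in w;
  star_pod0 : a \in n0 /\ c \in n0;
  star_pod1 : b \in n1 /\ c \in n1 }.

Lemma labels_on_edge s t u p q : s \in T -> t \in T -> u \in T -> p != q ->
    p \in s -> q \in s -> p \in t -> q \in t -> p \in u -> q \in u ->
    lab s <> lab t -> lab s <> lab u -> lab t <> lab u -> False.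
Proof.
move=> sT tT uT pq ps qs pt qt pu qu st su tu.
by have /or3P[] := edge_triangles_le2 triT sT tT uT pq ps qs pt qt pu qu => /eqP E;
  [case: st | case: su | case: tu]; rewrite E.
Qed.

Lemma hub_star_exists i : exists t a b c w n0 n1, hub_star i t a b c w n0 n1.
Proof.
have [t [w [tT wT tw lt lw]]] := dual_hub_edge_exists labT (i := i) (X := wing i) (eqxx i).
have [t0 [n0 [t0T n0T tn0 lt0 ln0]]] := dual_hub_edge_exists labT (i := i) (X := pod0) isT.
have [t1 [n1 [t1T n1T tn1 lt1 ln1]]] := dual_hub_edge_exists labT (i := i) (X := pod1) isT.
have t0E : t0 = t by apply: (dual_hub_inj labT) => //; rewrite lt0.
have t1E : t1 = t by apply: (dual_hub_inj labT) => //; rewrite lt1.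
subst t0 t1.
have /share_edgeP[_ [a [b [ab at_ bt aw bw]]]] := tw.
have [c [tE n1c]] := tri_edge triT tT at_ bt ab.
have ct : c \in t by rewrite tE in_fset3 eqxx !orbT.
have no_ab n j : n \in T -> lab n = pod j -> ~ (a \in n /\ b \in n).
  move=> nT ln [an bn].
  by apply: (labels_on_edge tT wT nT ab at_ bt aw bw an bn); rewrite ?lt ?lw ?ln.
have c_and n j : n \in T -> lab n = pod j -> share_edge t n -> c \in n /\ (a \in n \/ b \in n).
  move=> nT ln /share_edgeP[_ [x [y [xy xt yt xn yn]]]]; have := no_ab n j nT ln.
  move: xt yt; rewrite tE !in_fset3 => /or3P[] /eqP xE /or3P[] /eqP yE;
  rewrite xE in xn xy; rewrite yE in yn xy; rewrite ?eqxx // in xy;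
  by move=> nab; split; auto; case: nab.
have [cn0 abn0] := c_and n0 _ n0T ln0 tn0; have [cn1 abn1] := c_and n1 _ n1T ln1 tn1.
have ac := orient_neq0_uniq (norm1_neq0 n1c).
wlog an0 : a b ab at_ bt aw bw tE n1c no_ab c_and abn0 abn1 ac / a \in n0.
  move=> wl; case: abn0 => [an0|bn0]; first by apply: (wl a b) => //; left.
  apply: (wl b a) => //.
  - by rewrite eq_sym.
  - by rewrite fset3_swap12.
  - by rewrite orientC normrN.
  - by move=> n j nT ln [bn an]; apply: (no_ab n j).
  - by move=> n j nT ln /(c_and n j nT ln)[cn [|]]; auto.
  - by left.
  - by case: abn1; auto.
  - by case: ac => ? ? ?; rewrite eq_sym.
exists t, a, b, c, w, n0, n1; split=> //; split=> //.
case: abn1 => // an1; exfalso; have [_ _ nac] := ac.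
by apply: (labels_on_edge tT n0T n1T nac at_ ct an0 cn0 an1 cn1); rewrite ?lt ?ln0 ?ln1 // => -[].
Qed.

(** Two different parts which are not hubs are never adjacent. *)
Lemma frontier_of_part X p q : ~~ is_hub X -> p != q ->
    frontier_edge T (fun s => lab s == X) p q ->
  exists i s t, [/\ s \in T, t \in T, share_edge t s, lab s = X & lab t = hub i] /\
    [/\ p \in s, q \in s, p \in t & q \in t].
Proof.
move=> nX pq [s [t [sT tT /eqP sX tX [ps qs pt qt]]]].
have st : s != t by apply: contraNneq tX => <-; rewrite sX.
have shr : share_edge s t by apply: (share_edge_intro triT sT tT st pq).
have shr' : share_edge t s by apply: (share_edge_intro triT tT sT _ pq) => //; rewrite eq_sym.
have [i ti] : exists i, lab t = hub i.
  case E: (lab t) => [i|Y]; first by exists i.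
  have := dual_part_separated labT sT tT shr; rewrite sX E => /(_ nX isT) EX.
  by rewrite E EX eqxx in tX.
by exists i, s, t.
Qed.

(** The edge dual to the bridge is the whole frontier of the wing, whereas the
    frontier edges at an interior point never come alone. *)
Lemma hub_base_boundary_half i t a b c w n0 n1 p q : hub_star i t a b c w n0 n1 ->
  p != q -> p \in t -> q \in t -> p \in w -> q \in w -> ~ interior D (e p).
Proof.
move=> st pq pt qt pw qw pint.
have [tT wT _ _] := star_in st; have [lt lw _ _] := star_lab st.
have [tw _ _] := star_share st; have [tw' _] := share_edgeP tw.
have [|q1 [q1q pq1 fr]] := @frontier_edge_not_alone _ D T convexD triT
    (fun s => lab s == wing i) p q pint pq.
  by exists w, t; rewrite lw lt eqxx.
have [k [s [u [[sT uT us sX uX] [ps q1s pu q1u]]]]] := frontier_of_part (isT : ~~ is_hub (wing i)) pq1 fr.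
have ki : k = i.
  by apply/eqP; have := dual_hub_target labT uT sT us uX; rewrite sX /= eq_sym.
have ut : u = t by apply: (dual_hub_inj labT); rewrite ?uX ?lt ?ki.
have sw : s = w by apply: (dual_hub_edge_inj labT tT) => //; rewrite -?ut ?uX ?sX.
rewrite ut sw in q1u q1s.
case: (shared_vertex_on_edge triT tT wT tw' pq pt qt pw qw q1u q1s) => E.
  by rewrite E eqxx in pq1.
by rewrite E eqxx in q1q.
Qed.

Lemma hub_base_boundary i t a b c w n0 n1 : hub_star i t a b c w n0 n1 ->
  ~ interior D (e a) /\ ~ interior D (e b).
Proof.
move=> st; have [aw bw] := star_wing st; have tE := star_tri st.
have [ab _ _] := orient_neq0_uniq (norm1_neq0 (star_norm st)).
have [at_ bt] : a \in t /\ b \in t by rewrite tE !in_fset3 !eqxx orbT.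
split; first exact: hub_base_boundary_half st ab at_ bt aw bw.
by apply: (hub_base_boundary_half st _ bt at_ bw aw); rewrite eq_sym.
Qed.

(** A connected set of triangles can change sides only across pq, that is by
    passing from s to t. *)
Lemma part_on_one_side X s t (p q r : Z2) : split_edge D T s t p q ->
    s = [fset p; q; r]%fset -> `|orient p q r| = 1 ->
    ~~ is_hub X -> lab s <> X ->
  forall u v, u \in T -> v \in T -> lab u = X -> lab v = X ->
    on_side p q r u = on_side p q r v.
Proof.
move=> spl sE n1 nX sX; apply: (dual_part_connected labT nX) => u v uT vT uv uX vX.
have vu : share_edge v u.
  by move: uv; rewrite /share_edge eq_sym fsetIC.
have [su|su] := boolP (on_side p q r u); have [sv|sv] := boolP (on_side p q r v) => //.
  by have [us _] := on_side_adjacent convexD triT spl sE n1 uT vT uv su sv; rewrite us in uX.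
by have [vs _] := on_side_adjacent convexD triT spl sE n1 vT uT vu sv su; rewrite vs in vX.
Qed.

Lemma adjacent_on_side s t (p q r : Z2) u v : split_edge D T s t p q ->
    s = [fset p; q; r]%fset -> `|orient p q r| = 1 ->
    u \in T -> v \in T -> share_edge u v -> v <> s -> u <> s \/ v <> t ->
  on_side p q r u -> on_side p q r v.
Proof.
move=> spl sE n1 uT vT uv vs nst su; apply/negPn/negP => sv.
by have [us vt] := on_side_adjacent convexD triT spl sE n1 uT vT uv su sv; case: nst.
Qed.

Lemma ord2_cases (i j k : 'I_2) : i != j -> k = i \/ k = j.
Proof.
move=> ij; have [->|ki] := eqVneq k i; first by left.
right; apply: val_inj; move: ij ki (ltn_ord i) (ltn_ord j) (ltn_ord k).
by rewrite -!val_eqE /=; lia.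
Qed.

(** Otherwise ac is a splitting edge. Starting from t, pod 1 is reached without
    crossing ac, and from pod 1 the other hub t', so t' is on the side of t;
    starting from n0, across ac, pod 0 leads to t' on the other side. *)
Lemma hub_apex_interior i i' t a b c w n0 n1 t' a' b' c' w' n0' n1' : i != i' ->
    hub_star i t a b c w n0 n1 -> hub_star i' t' a' b' c' w' n0' n1' ->
  interior D (e c).
Proof.
move=> ii' st st'; apply: contrapT => cN.
have [aN _] := hub_base_boundary st.
have [tT _ n0T n1T] := star_in st; have [lt _ l0 l1] := star_lab st.
have [_ tn0 tn1] := star_share st; have [ntn0 _] := share_edgeP tn0.
have [t'T _ n0'T n1'T] := star_in st'; have [lt' _ l0' l1'] := star_lab st'.
have [_ t'n0' t'n1'] := star_share st'.
have [an0 cn0] := star_pod0 st.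
have tE : t = [fset a; c; b]%fset by rewrite (star_tri st) fset3_swap23.
have [n1b acn _] := orient_perm_norm1 (star_norm st).
have [ac _ _] := orient_neq0_uniq (norm1_neq0 acn).
have [at_ ct] : a \in t /\ c \in t by rewrite tE !in_fset3 !eqxx orbT.
have spl : split_edge D T t n0 a c by split.
have tt' : t' <> t by move=> E; rewrite E lt in lt'; case: lt' => /eqP; rewrite (negbTE ii').
have t_on := on_side_self spl tE; have n0_off := on_side_twin triT spl tE acn.
have pods j (nj : lab t <> pod j) := @part_on_one_side (pod j) _ _ _ _ _ spl tE acn isT nj.
have n1_on : on_side a c b n1.
  apply: (adjacent_on_side spl tE acn tT n1T tn1) => //.
    by move=> E; rewrite E lt in l1.
  by right=> E; rewrite E l0 in l1; case: l1.
have n1'_on : on_side a c b n1' by rewrite -(pods ord_max _ n1) // lt.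
have t'_on : on_side a c b t'.
  apply: (adjacent_on_side spl tE acn n1'T t'T _ tt' _ n1'_on).
    by move: t'n1'; rewrite /share_edge eq_sym fsetIC.
  by left=> E; rewrite E lt in l1'.
have n0'_on : on_side a c b n0'.
  apply: (adjacent_on_side spl tE acn t'T n0'T t'n0' _ _ t'_on); last by left.
  by move=> E; rewrite E lt in l0'.
by move: n0_off; rewrite (pods ord0 _ n0 n0') ?n0'_on // lt.
Qed.

(** The frontier of each pod consists of one edge of t and one edge of t', so at
    the interior point c both edges are present: c is on the edges of t' towards
    both pods, whose common point is c'. *)
Lemma hub_apex_in_other i i' t a b c w n0 n1 t' a' b' c' w' n0' n1' : i != i' ->
    hub_star i t a b c w n0 n1 -> hub_star i' t' a' b' c' w' n0' n1' ->
  c = c'.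
Proof.
move=> ii' st st'; have cint := hub_apex_interior ii' st st'.
have [tT _ n0T n1T] := star_in st; have [lt _ l0 l1] := star_lab st.
have [_ tn0 tn1] := star_share st.
have [t'T _ n0'T n1'T] := star_in st'; have [lt' _ l0' l1'] := star_lab st'.
have [_ t'n0' t'n1'] := star_share st'.
have tE := star_tri st; have t'E := star_tri st'.
have [at_ bt ct] : [/\ a \in t, b \in t & c \in t] by rewrite tE !in_fset3 !eqxx !orbT.
have [a't bt' ct'] : [/\ a' \in t', b' \in t' & c' \in t'] by rewrite t'E !in_fset3 !eqxx !orbT.
have [ab bc ac] := orient_neq0_uniq (norm1_neq0 (star_norm st)).
have [ab' bc' ac'] := orient_neq0_uniq (norm1_neq0 (star_norm st')).
(* At the interior point c the edge from t to pod j separates pod j from the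
   rest; the next such edge at c can only belong to the other hub. *)
have step j x n n' : n \in T -> n' \in T -> lab n = pod j -> lab n' = pod j ->
    share_edge t n -> share_edge t' n' -> c != x -> x \in t -> x \in n -> c \in n ->
    c \in t' /\ c \in n'.
  move=> nT n'T ln ln' tn t'n' cx xt xn cn.
  have [|q1 [q1x cq1 fr]] := @frontier_edge_not_alone _ D T convexD triT
      (fun s => lab s == pod j) c x cint cx.
    by exists n, t; rewrite ln lt eqxx.
  have [k [s [u [[sT uT us sX uX] [cs q1s cu q1u]]]]] :=
    frontier_of_part (isT : ~~ is_hub (pod j)) cq1 fr.
  have [ki|ki'] := ord2_cases k ii'; last first.
    have ut : u = t' by apply: (dual_hub_inj labT); rewrite ?uX ?lt' ?ki'.
    have sn : s = n' by apply: (dual_hub_edge_inj labT t'T) => //; rewrite -?ut ?uX ?sX.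
    by rewrite -ut -sn.
  have ut : u = t by apply: (dual_hub_inj labT); rewrite ?uX ?lt ?ki.
  have sn : s = n by apply: (dual_hub_edge_inj labT tT) => //; rewrite -?ut ?uX ?sX.
  rewrite ut sn in q1u q1s; have [tn_neq _] := share_edgeP tn.
  case: (shared_vertex_on_edge triT tT nT tn_neq cx ct xt cn xn q1u q1s) => E.
    by rewrite E eqxx in cq1.
  by rewrite E eqxx in q1x.
have [an0 cn0] := star_pod0 st; have [bn1 cn1] := star_pod1 st.
have [an0' cn0'] := star_pod0 st'; have [bn1' cn1'] := star_pod1 st'.
have [t'n0'_neq _] := share_edgeP t'n0'; have [t'n1'_neq _] := share_edgeP t'n1'.
have [ct0 c0] : c \in t' /\ c \in n0'.
  by apply: (step ord0 a n0) => //; rewrite eq_sym.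
have [_ c1] : c \in t' /\ c \in n1'.
  by apply: (step ord_max b n1) => //; rewrite eq_sym.
have [ca|//] := shared_vertex_on_edge triT t'T n0'T t'n0'_neq ac' a't ct' an0' cn0' ct0 c0.
have [cb|//] := shared_vertex_on_edge triT t'T n1'T t'n1'_neq bc' bt' ct' bn1' cn1' ct0 c1.
by rewrite -ca cb eqxx in ab'.
Qed.

Lemma hub_base_split i t a b c w n0 n1 : hub_star i t a b c w n0 n1 ->
  split_edge D T t w a b.
Proof.
move=> st; have [tT wT _ _] := star_in st; have [tw _ _] := star_share st.
have [tw' _] := share_edgeP tw; have [aw bw] := star_wing st.
have [ab _ _] := orient_neq0_uniq (norm1_neq0 (star_norm st)).
split; last exact: hub_base_boundary st.
by split=> //; rewrite (star_tri st) !in_fset3 !eqxx orbT.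
Qed.

Lemma weight_apex (a b c z : Z2) : weight c a b z = orient a b c * orient a b z.
Proof. by rewrite /weight -orient_rot. Qed.

(** The wing lies beyond ab, and its core gives an interior vertex, which is not
    on the line ab because D meets this line in boundary points and in the edge
    ab only. *)
Lemma wing_interior_vertex i t a b c w n0 n1 : hub_star i t a b c w n0 n1 ->
  exists2 y, interior D (e y) & weight c a b y < 0.
Proof.
move=> st; have spl := hub_base_split st.
have [tT wT n0T n1T] := star_in st; have [lt lw l0 l1] := star_lab st.
have tE := star_tri st; have n1c := star_norm st.
have [A [Aex Asym AT Acomp AX]] := dual_part_core labT (isT : ~~ is_hub (wing i)).
have [s [u [y [Asu ys yu yint]]]] := core_interior_vertex convexD triT Aex Asym AT Acomp.
exists y => //; have [sT _ _] := AT _ _ Asu.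
have s_off : ~~ on_side a b c s.
  have nt : lab t <> wing i by rewrite lt.
  rewrite (part_on_one_side (X := wing i) spl tE n1c isT nt sT wT (AX _ _ Asu) lw).
  exact: (on_side_twin triT spl tE n1c).
have le0 := off_side_le0 convexD triT spl n1c sT s_off ys.
rewrite weight_apex lt_neqAle le0 andbT mulf_eq0 (negbTE (norm1_neq0 n1c)) /=.
apply/negP => /eqP y0; have [aN bN] := hub_base_boundary st.
by have [E|E] := split_line_vertex convexD triT spl sT ys y0; rewrite E in yint.
Qed.

Lemma pod0_on_apex_side i t a b c w n0 n1 s z : hub_star i t a b c w n0 n1 ->
  s \in T -> lab s = pod0 -> z \in s -> 0 <= weight c a b z.
Proof.
move=> st sT ls zs; have spl := hub_base_split st.
have [tT wT n0T n1T] := star_in st; have [lt lw l0 l1] := star_lab st.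
have tE := star_tri st; have n1c := star_norm st; have [_ tn0 _] := star_share st.
rewrite weight_apex; suff /allP : on_side a b c s by apply.
have nt : lab t <> pod0 by rewrite lt.
rewrite (part_on_one_side (X := pod0) spl tE n1c isT nt sT n0T ls l0).
apply: (adjacent_on_side spl tE n1c tT n0T tn0).
- by move=> E; rewrite E lt in l0.
- by right=> E; rewrite E lw in l0.
exact: (on_side_self spl tE).
Qed.

Lemma two_apex_side i t a b c w n0 n1 s z : hub_star i t a b c w n0 n1 ->
  s \in T -> c \in s -> z \in s -> 0 <= weight c a b z.
Proof.
move=> st sT cs zs; have spl := hub_base_split st; have n1c := star_norm st.
rewrite weight_apex; suff /allP : on_side a b c s by apply.
apply/negPn/negP => off; have := off_side_le0 convexD triT spl n1c sT off cs.
by rewrite leNgt -expr2 exprn_even_gt0 // norm1_neq0.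
Qed.

(** A unimodular triangle has no lattice points besides its vertices. *)
Lemma cone_vertex (a b c z : Z2) : `|orient a b c| = 1 ->
    0 <= weight a b c z -> 0 <= weight b c a z -> 0 <= weight c a b z ->
  [\/ z = a, z = b | z = c].
Proof.
move=> n1 wa wb wc; have sum1 := weight_sum z n1.
have zE := weight_decomp z n1.
have [[E1 [E2 E3]]|[[E1 [E2 E3]]|[E1 [E2 E3]]]] :
    (weight a b c z = 1 /\ weight b c a z = 0 /\ weight c a b z = 0) \/
    (weight a b c z = 0 /\ weight b c a z = 1 /\ weight c a b z = 0) \/
    (weight a b c z = 0 /\ weight b c a z = 0 /\ weight c a b z = 1) by lia.
- by constructor 1; rewrite zE E1 E2 E3 !scale0r scale1r !addr0.
- by constructor 2; rewrite zE E1 E2 E3 !scale0r scale1r addr0 add0r.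
by constructor 3; rewrite zE E1 E2 E3 !scale0r scale1r !add0r.
Qed.

Lemma star_vertical_angles i t a b c w n0 n1 z : hub_star i t a b c w n0 n1 ->
    D (e z) ->
  (0 <= weight a b c z /\ 0 <= weight b c a z) \/
  (weight a b c z <= 0 /\ weight b c a z <= 0).
Proof.
move=> st zD; have [tT _ _ _] := star_in st; have [aN bN] := hub_base_boundary st.
have [y yint y0] := wing_interior_vertex st; have tE := star_tri st.
have tD v : v \in t -> D (e v) by apply: (vertexD triT).
apply: (vertical_angles convexD (star_norm st) _ _ _ aN bN yint y0 zD);
  by apply: tD; rewrite tE in_fset3 eqxx ?orbT.
Qed.

Lemma weight_apex_eq0 (a b c : Z2) : weight a b c c = 0 /\ weight b c a c = 0.
Proof. by rewrite /weight orient_xyx orient_xyy !mulr0. Qed.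

(** A vertex of t' in the angle of t would be a, b or c, as it is on the same side
    of ab as c; then t and t' would be adjacent. *)
Lemma hub_in_opposite_angle i i' t a b c w n0 n1 t' a' b' w' n0' n1' z : i != i' ->
    hub_star i t a b c w n0 n1 -> hub_star i' t' a' b' c w' n0' n1' ->
    z \in t' -> weight a b c z <= 0 /\ weight b c a z <= 0.
Proof.
move=> ii' st st' zt'.
have [tT _ _ _] := star_in st; have [lt _ _ _] := star_lab st.
have [t'T _ _ _] := star_in st'; have [lt' _ _ _] := star_lab st'.
have tE := star_tri st; have t'E := star_tri st'; have n1c := star_norm st.
have ct' : c \in t' by rewrite t'E in_fset3 eqxx !orbT.
have tt' : t != t'.
  by apply: contraNneq ii' => E; rewrite E lt' in lt; case: lt => ->.
have [|//] := star_vertical_angles st (vertexD triT t'T zt').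
move=> [wa wb]; have wc := two_apex_side st t'T ct' zt'.
have not_shared x : x \in t -> x != c -> z != x.
  move=> xt xc; apply: contraNneq ii' => zx; rewrite zx in zt'.
  have ct : c \in t by rewrite tE in_fset3 eqxx !orbT.
  have shr := share_edge_intro triT tT t'T tt' xc xt ct zt' ct'.
  by have := dual_hub_target labT tT t'T shr lt; rewrite lt'.
have [_ bc ac] := orient_neq0_uniq (norm1_neq0 n1c).
have [at_ bt] : a \in t /\ b \in t by rewrite tE !in_fset3 !eqxx orbT.
have [E|E|->] := cone_vertex n1c wa wb wc.
- by have := not_shared a at_ ac; rewrite E eqxx.
- by have := not_shared b bt bc; rewrite E eqxx.
by have [-> ->] := weight_apex_eq0 a b c.
Qed.

(** * No room for a pod *)

(** A vertex of pod 0 outside the angles of both hubs would be in the angle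
    opposite to that of t', which is contained in the angle of t. So all vertices of pod 0 are
    vertices of hubs, and n0 is the only triangle of pod 0: the other candidates
    are excluded by the triangles which are already present at the edges ab, bc
    and a'b'. A core needs more than one triangle. *)
Lemma no_tie_fighter_triangulation : False.
Proof.
have [t [a [b [c [w [n0 [n1 st]]]]]]] := hub_star_exists ord0.
have [t' [a' [b' [c' [w' [n0' [n1' st']]]]]]] := hub_star_exists ord_max.
have ii' : (ord0 : 'I_2) != ord_max by [].
have i'i : (ord_max : 'I_2) != ord0 by [].
have cc' := hub_apex_in_other ii' st st'; rewrite -{}cc' in st'.
have [tT wT n0T n1T] := star_in st; have [lt lw l0 l1] := star_lab st.
have [t'T w'T n0'T n1'T] := star_in st'; have [lt' lw' l0' l1'] := star_lab st'.
have tE := star_tri st; have t'E := star_tri st'.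
have n1c := star_norm st; have n1c' := star_norm st'.
have [at_ bt ct] : [/\ a \in t, b \in t & c \in t] by rewrite tE !in_fset3 !eqxx !orbT.
have [a't bt' ct'] : [/\ a' \in t', b' \in t' & c \in t'] by rewrite t'E !in_fset3 !eqxx !orbT.
have [ab bc ac] := orient_neq0_uniq (norm1_neq0 n1c).
have [ab' bc' ac'] := orient_neq0_uniq (norm1_neq0 n1c').
have [aw bw] := star_wing st; have [aw' bw'] := star_wing st'.
have [an0 cn0] := star_pod0 st; have [bn1 cn1] := star_pod1 st.
have vertices s z : s \in T -> lab s = pod0 -> z \in s ->
      z = a \/ z = b \/ z = c \/ z = a' \/ z = b'.
  move=> sT ls zs; have zD := vertexD triT sT zs.
  have wc := pod0_on_apex_side st sT ls zs; have wc' := pod0_on_apex_side st' sT ls zs.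
  have [[wa' wb']|[wa' wb']] := star_vertical_angles st' zD.
    by case: (cone_vertex n1c' wa' wb' wc'); auto.
  suff [wa wb] : 0 <= weight a b c z /\ 0 <= weight b c a z.
    by case: (cone_vertex n1c wa wb wc); auto.
  have [aa' ba'] := hub_in_opposite_angle ii' st st' a't.
  have [ab'' bb''] := hub_in_opposite_angle ii' st st' bt'.
  have [ca cb] := weight_apex_eq0 a b c.
  rewrite (weight_comb a b c z n1c') (weight_comb b c a z n1c') ca cb !mulr0 !addr0.
  by split; apply: addr_ge0; apply: mulr_le0.
have not_ab s : s \in T -> lab s = pod0 -> ~ (a \in s /\ b \in s).
  move=> sT ls [as_ bs].
  by apply: (labels_on_edge tT wT sT ab at_ bt aw bw as_ bs); rewrite ?lt ?lw ?ls.
have not_ab' s : s \in T -> lab s = pod0 -> ~ (a' \in s /\ b' \in s).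
  move=> sT ls [as_ bs].
  by apply: (labels_on_edge t'T w'T sT ab' a't bt' aw' bw' as_ bs); rewrite ?lt' ?lw' ?ls.
have only_n0 s : s \in T -> lab s = pod0 -> s = n0.
  move=> sT ls; have nab := not_ab s sT ls; have nab' := not_ab' s sT ls.
  have [cs abs] : c \in s /\ (a \in s \/ b \in s).
    have [x [y [z [sE /norm1_neq0 /orient_neq0_uniq[xy yz xz]]]]] := tri_exists triT sT.
    have [xs ys zs] : [/\ x \in s, y \in s & z \in s] by rewrite sE !in_fset3 !eqxx !orbT.
    have := vertices s x sT ls xs; have := vertices s y sT ls ys; have := vertices s z sT ls zs.
    move=> zV yV xV.
    case: xV => [xE|[xE|[xE|[xE|xE]]]]; rewrite xE in xs xy xz;
    case: yV => [yE|[yE|[yE|[yE|yE]]]]; rewrite yE in ys xy yz; rewrite ?eqxx // in xy;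
    case: zV => [zE|[zE|[zE|[zE|zE]]]]; rewrite zE in zs xz yz; rewrite ?eqxx // in xz yz;
    solve [by split; auto | by case: nab | by case: nab'].
  have nbs : ~ b \in s.
    by move=> bs; apply: (labels_on_edge tT n1T sT bc bt ct bn1 cn1 bs cs);
      rewrite ?lt ?l1 ?ls.
  have [as_|//] : a \in s \/ b \in s := abs.
  have := edge_triangles_le2 triT tT n0T sT ac at_ ct an0 cn0 as_ cs.
  case/or3P => /eqP E //; first by rewrite E l0 in lt.
  by rewrite E ls in lt.
have [A [[s [u Asu]] Asym AT _ AX]] := dual_part_core labT (isT : ~~ is_hub pod0).
have [sT uT /share_edgeP[su _]] := AT _ _ Asu.
have sE := only_n0 s sT (AX _ _ Asu); have uE := only_n0 u uT (AX _ _ (Asym _ _ Asu)).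
by rewrite sE uE eqxx in su.
Qed.

End NoTieFighter.

Theorem theorem3p4 (R : realType) (G : mgraph) :
  tie_fighter R G -> ~ troplanar R G.
Proof.
move=> tie [D [_ [T [S [[[[A DA] _] _] triT _ skel iso]]]]].
have convexD : segment_closed D.
  by move=> x y t; rewrite DA; apply: convex_hull_convex.
have [lab labP] := skeleton_tie_labelling tie iso skel (dual_degree_le3 triT).
have [L labL] := dual_labelling_of_graph labP.
exact: no_tie_fighter_triangulation convexD triT labL.
Qed.
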